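(* There are absolute constants $c>0$ and $C>0$ such that the following holds. Let $p$ be a prime and let $A$ be a set of generators of $G=\operatorname{SL}_2(\mathbb{Z}/p\mathbb{Z})$. Then the Cayley graph $\Gamma(G,A)$ has diameter at most $C(\log p)^c$.
   Context: For a finite group $G$ and a set $A$ of generators of $G$, the Cayley graph $\Gamma(G,A)$ is the (undirected) graph with vertex set $G$ and edge set $\{(ag,g): g\in G, a\in A\}$. The diameter of a graph is the maximum over pairs of vertices $v_1,v_2$ of the length $d(v_1,v_2)$ of the shortest path between them. Thus the diameter of $\Gamma(G,A)$ is the least $\ell$ such that every element of $G$ is a product of at most $\ell$ elements of $A\cup A^{-1}$. *)

(* Defs.v *)
From mathcomp Require Import all_boot all_order all_algebra all_fingroup.
From mathcomp Require Import all_classical all_reals all_analysis.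

Set Implicit Arguments.
Unset Strict Implicit.
Unset Printing Implicit Defensive.

Import Order.TTheory GRing.Theory Num.Theory.
Local Open Scope ring_scope.

Section SpecialLinear.
Variables (n : nat) (F : finComUnitRingType).

(* As for 'GL_n, matrices have size n.-1.+1, so n is meant to be positive. *)
Definition SL : {set {'GL_n[F]}} := finset (fun u : {'GL_n[F]} => \det (GLval u) == 1).

Lemma SL_group_set : group_set SL.
Proof.
apply/group_setP; split=> [|u v]; first by rewrite inE det1.
by rewrite !inE det_mulmx => /eqP -> /eqP ->; rewrite mulr1.
Qed.

Canonical SL_group := Group SL_group_set.
End SpecialLinear.

Notation "''SL_' n [ F ]" := (SL n F)
  (at level 8, n at level 2, format "''SL_' n [ F ]") : group_scope.

(* The undirected graph with edges {a * g, g} for g \in G and a \in A; its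
   vertices are the elements of G, and A is meant to be a subset of G, so that
   every edge joins two elements of G. *)
Definition cayley_graph (gT : finGroupType) (G A : {set gT}) : rel gT :=
  fun x y => [exists a in A, (y \in G) && (x == (a * y)%g)
                          || (x \in G) && (y == (a * x)%g)].

Section Diameter.
Variables (R : realType) (T : finType).

(* Extended-real valued, so that unreachable vertices are at distance +oo. *)
Definition graph_dist (e : rel T) (x y : T) : \bar R :=
  ereal_inf [set (size s)%:R%:E | s in [set s : seq T | path e x s /\ last x s = y]]%classic.

(* V is the vertex set: e should have no edge leaving V. *)
Definition diameter (V : {set T}) (e : rel T) : \bar R :=
  ereal_sup [set graph_dist e z.1 z.2 | z in [set z : T * T | z.1 \in V /\ z.2 \in V]]%classic.
End Diameter.
Arguments graph_dist R {T}.
Arguments diameter R {T}.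

(* Main.v *)
(** Let q be the size of a finite field F, G = SL_2(F), and let A = A^-1 generate G, with
    1 in A and growth constant M = |A^64|.  A torus is the centralizer C(g) of some g
    with tr(g)^2 <> 4.

    - Escape: bounded products of A contain an x such that g and x g x^-1 have no common
      eigenline.  Otherwise all the traces tr(y y'), for y and y' in a ball of the conjugation
      orbit of g, take only two values; pairing with a basis shows that the orbit has
      at most 8 elements.
    - Upper bounds: (d1, d2, d3) |-> d1 x d2 x^-1 d3 gives |A^2 :&: C(g)|^3 <= O(M).  A set
      S of elements of given trace has at least (|S| / 2)^(1/2) distinct traces after
      multiplication by g or x g x^-1.  Each trace contributes a disjoint conjugation orbit,
      which is large by the bound on tori, whence |S| <= M^(2/3) up to growth factors.
    - By orbit-stabilizer, a torus meeting A^2 in a noncentral element contains at least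
      |A|^(1/3) elements of A^2, up to growth factors.
    - Pivoting (Helfgott): if x C(g) x^-1 meets A^2 nontrivially but its conjugate by some a in
      A does not, then A * a (A^2 :&: x C(g) x^-1) a^-1 has about |A|^(4/3) elements.
      Otherwise all conjugates of C(g) meet A^2, so that M is at least about
      q^2 |A|^(1/3).  Both give power growth as long as |A| <= q^(14/5).
    - When |A| > q^(14/5), A^2 contains many diagonal and many unipotent matrices, and a second
      moment count of point-line incidences shows X Y + W + V = F for the sets of
      parameters; hence A^10 contains the unipotent subgroups and A^40 = G.
    - O(log log q) growth steps, each multiplying the radius by 64, reach q^(14/5). *)

Require Import Defs.
From mathcomp Require Import all_boot all_order all_algebra all_fingroup.
From mathcomp Require Import ring lra zify.

Set Implicit Arguments.
Unset Strict Implicit.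
Unset Printing Implicit Defensive.

Import Order.TTheory GRing.Theory Num.Theory.

Local Open Scope nat_scope.

(** * Counting and balls in finite groups *)

Section Counting.

Lemma leq_card_fibers (T1 T2 : finType) (X : {set T1}) (Y : {set T2})
    (f : T1 -> T2) (n : nat) :
  {in X, forall x, f x \in Y} ->
  {in X, forall x, #|[set x' in X | f x' == f x]| <= n} ->
  #|X| <= n * #|Y|.
Proof.
move=> fXY fib; rewrite -sum1_card (partition_big_imset f) /=.
have imY : [set f x | x in X] \subset Y.
  by apply/subsetP => _ /imsetP[x xX ->]; apply: fXY.
apply: (@leq_trans (\sum_(y in [set f x | x in X]) n)).
  apply: leq_sum => _ /imsetP[x xX ->]; apply: leq_trans (fib x xX).
  by rewrite -sum1_card; apply: eq_leq; apply: eq_bigl => z; rewrite inE.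
by rewrite sum_nat_const mulnC leq_mul2l subset_leq_card ?orbT.
Qed.

Lemma geq_card_fibers (T1 T2 : finType) (X : {set T1}) (Y : {set T2})
    (f : T1 -> T2) (n : nat) :
  {in Y, forall y, n <= #|[set x in X | f x == y]|} -> n * #|Y| <= #|X|.
Proof.
move=> fib; rewrite mulnC -sum_nat_const.
apply: leq_trans (leq_sum _ fib) _.
rewrite -[leqRHS]sum1_card (partition_big f predT) //= [leqRHS](bigID (mem Y)) /=.
apply: leq_trans (leq_addr _ _).
apply: leq_sum => y _; rewrite -sum1_card; apply: eq_leq.
by apply: eq_bigl => x; rewrite inE.
Qed.

Lemma card_le2 (T : finType) (X : {set T}) :
  (forall x y z, x \in X -> y \in X -> z \in X -> y != x -> z != x -> y = z) ->
  #|X| <= 2.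
Proof.
move=> h; case: (set_0Vmem X) => [->|[x xX]]; first by rewrite cards0.
rewrite (cardsD1 x) xX add1n ltnS leqNgt; apply/negP => /card_gt1P[y [z]].
rewrite !inE => -[/andP[yx yX] /andP[zx zX]] /eqP; apply.
exact: (h x).
Qed.

Lemma card_leq_inj (T1 T2 : finType) (X : {set T1}) (Y : {set T2})
    (f : T1 -> T2) :
  {in X, forall x, f x \in Y} -> {in X &, injective f} -> #|X| <= #|Y|.
Proof.
move=> fXY finj; rewrite -(card_in_imset finj); apply: subset_leq_card.
by apply/subsetP => _ /imsetP[x xX ->]; apply: fXY.
Qed.

(** Every strict inclusion in the chain adds at least one element. *)
Lemma chain_stab_or_grow (T : finType) (B : nat -> {set T}) (k : nat) :
  (forall j, B j \subset B j.+1) -> 0 < #|B 0| ->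
  k < #|B k| \/ exists2 j, j < k & B j.+1 = B j.
Proof.
move=> sB B0; elim: k => [|k [IH|[j jk e]]]; first by left.
  have [e|ne] := eqVneq (B k.+1) (B k); first by right; exists k.
  left; apply: leq_ltn_trans IH _; apply: proper_card.
  by rewrite properEneq eq_sym ne sB.
by right; exists j => //; apply: ltnW.
Qed.

End Counting.

(** * Balls and conjugation orbits of a symmetric generating set *)

Section Balls.
Local Open Scope group_scope.
Variables (gT : finGroupType) (A : {set gT}).
Hypotheses (A1 : 1 \in A) (AV : A^-1 = A).
Implicit Types (x y g h : gT) (H G : {group gT}).

Lemma gen_mull_ind (P : gT -> Prop) :
  P 1 -> (forall a x, a \in A -> P x -> P (a * x)) ->
  forall x, x \in <<A>> -> P x.
Proof.
move=> P1 PM x; have [n ->] := gen_expgs A.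
have -> : 1 |: A = A by apply/setUidPr; rewrite sub1set.
elim: n x => [x|n IH x].
  by rewrite expg0 => /set1P ->.
by rewrite expgS => /mulsgP[a y aA yA ->]; apply: PM => //; apply: IH.
Qed.

Lemma ball_mul i j x y : x \in A ^+ i -> y \in A ^+ j -> x * y \in A ^+ (i + j).
Proof. by move=> xA yA; rewrite expgnDr mem_mulg. Qed.

Lemma ball_inv i x : x \in A ^+ i -> x^-1 \in A ^+ i.
Proof.
move=> xA; by rewrite -AV expVgn mem_invg invgK.
Qed.

Lemma ball_one i : 1 \in A ^+ i.
Proof.
elim: i => [|i IH]; first by rewrite expg0 set11.
by rewrite expgS -[1]mul1g mem_mulg.
Qed.

Lemma ball_sub i j : i <= j -> A ^+ i \subset A ^+ j.
Proof.
move=> ij; apply/subsetP => x xA; rewrite -(subnKC ij) -[x]mulg1.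
by rewrite ball_mul ?ball_one.
Qed.

Lemma ball_le i j x : i <= j -> x \in A ^+ i -> x \in A ^+ j.
Proof. by move=> ij; apply: subsetP; apply: ball_sub. Qed.

Lemma ball_mulV i x y : x \in A ^+ i -> y \in A ^+ i -> x^-1 * y \in A ^+ (i + i).
Proof. by move=> xA yA; rewrite ball_mul ?ball_inv. Qed.

Lemma ball_gen i : A ^+ i \subset <<A>>.
Proof.
elim: i => [|i IH]; first by rewrite expg0 sub1G.
by rewrite expgS mul_subG ?subset_gen.
Qed.

Lemma ball_stable j : A ^+ j.+1 = A ^+ j -> A ^+ j = <<A>>.
Proof.
move=> e; apply/eqP; rewrite eqEsubset ball_gen /=; apply/subsetP => x.
apply: (gen_mull_ind (P := fun x => x \in A ^+ j)); first exact: ball_one.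
by move=> a y aA yA; rewrite -e expgS mem_mulg.
Qed.

Lemma ball_growth k : k < #|A ^+ k| \/ A ^+ k = <<A>>.
Proof.
case: (@chain_stab_or_grow _ (fun j => A ^+ j) k).
- by move=> j; apply: ball_sub.
- by rewrite expg0 cards1.
- by left.
case=> j jk /ball_stable e; right; apply/eqP; rewrite eqEsubset ball_gen -e.
by apply: ball_sub; apply: ltnW.
Qed.

(** A crude radius, good enough for the finitely many small fields. *)
Lemma ball_card_full G : <<A>> = G -> A ^+ #|G| = G.
Proof.
move=> genA; case: (ball_growth #|G|) => [|-> //].
by rewrite ltnNge subset_leq_card // -genA ball_gen.
Qed.

(** Pigeonhole over the left cosets of [H]: elements of [A] in the same coset have their quotients
    in [A ^+ 2 :&: H]. *)
Lemma card_coset_ball G H :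
  A \subset G -> H \subset G -> (#|A| * #|H| <= #|A ^+ 2 :&: H| * #|G|)%N.
Proof.
move=> sAG sHG; rewrite -(Lagrange sHG) mulnCA (mulnC #|H|) leq_mul2r.
apply/orP; right; rewrite -card_lcosets.
apply: (@leq_card_fibers _ _ _ _ (fun a => a *: H)).
  by move=> a aA; apply/lcosetsP; exists a; rewrite ?(subsetP sAG).
move=> a aA; apply: (@card_leq_inj _ _ _ _ (fun b => a^-1 * b)).
  move=> b; rewrite !inE => /andP[bA /eqP e].
  rewrite expgS expg1 mem_mulg ?(ball_inv (i := 1)) //=.
  by rewrite -mem_lcoset -e lcoset_refl.
by move=> b c _ _ /mulgI.
Qed.

Definition conj_ball g j : {set gT} := [set x * g * x^-1 | x in A ^+ j].

Lemma mem_conj_ball g j x : x \in A ^+ j -> x * g * x^-1 \in conj_ball g j.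
Proof. by move=> xA; apply/imsetP; exists x. Qed.

(** Approximate orbit-stabilizer: two elements of [A] that conjugate [g] to the same element differ
    by an element of [A ^+ 2] centralizing [g]. *)
Lemma card_conj_ball g :
  (#|A| <= #|A ^+ 2 :&: 'C[g]| * #|conj_ball g 1|)%N.
Proof.
apply: (@leq_card_fibers _ _ _ _ (fun a => a * g * a^-1)).
  by move=> a aA; apply: mem_conj_ball; rewrite expg1.
move=> a aA; apply: (@card_leq_inj _ _ _ _ (fun b => a^-1 * b)).
  move=> b; rewrite in_set in_setI => /andP[bA /eqP e].
  rewrite expgS expg1 mem_mulg ?(ball_inv (i := 1)) //=.
  apply/cent1P; rewrite /commute.
  have -> : a^-1 * b * g = a^-1 * (b * g * b^-1) * b by rewrite !mulgA mulgKV.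
  by rewrite e !mulgA mulVg mul1g.
by move=> b c _ _ /mulgI.
Qed.

(** Once the chain of partial orbits stalls, it is stable under conjugation by [A], hence by the
    whole group. *)
Lemma conj_ball_growth g k :
  k < #|conj_ball g k| \/
  (forall x, x \in <<A>> -> x * g * x^-1 \in conj_ball g k).
Proof.
case: (@chain_stab_or_grow _ (conj_ball g) k).
- by move=> j; apply: imsetS; apply: ball_sub.
- by apply/card_gt0P; exists (1 * g * 1^-1); apply: mem_conj_ball; apply: ball_one.
- by left.
case=> j jk e; right => x xG.
suff : x * g * x^-1 \in conj_ball g j.
  by apply: subsetP; apply: imsetS; apply: ball_sub; apply: ltnW.
move: x xG; apply: gen_mull_ind; first by apply: mem_conj_ball; apply: ball_one.
move=> a x aA /imsetP[y yA exy]; rewrite -e.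
have -> : a * x * g * (a * x)^-1 = a * y * g * (a * y)^-1.
  by rewrite !invMg !mulgA -!(mulgA a) exy !mulgA.
by apply: mem_conj_ball; rewrite expgS mem_mulg.
Qed.

End Balls.

Local Open Scope ring_scope.

(** * Two by two matrices *)

Section Entries.
Variable F : finFieldType.

(* Conversion between the magma structure of [{'GL_2[F]}] and the one inherited
   from its finite group structure is very slow; this alias fixes the latter. *)
Definition GL2 : finGroupType := {'GL_2[F]}.
Definition SL2 : {group GL2} := SL_group 2 F.
Implicit Types u v g h x : GL2.

Definition e11 u : F := GLval u (0 : 'I_2) (0 : 'I_2).
Definition e12 u : F := GLval u (0 : 'I_2) (1 : 'I_2).
Definition e21 u : F := GLval u (1 : 'I_2) (0 : 'I_2).
Definition e22 u : F := GLval u (1 : 'I_2) (1 : 'I_2).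
Definition tr2 u : F := e11 u + e22 u.

Lemma ord2P (P : 'I_2 -> Prop) : P 0 -> P 1 -> forall i, P i.
Proof.
move=> P0 P1 [[|[|//]] h]; first by rewrite (_ : Ordinal h = 0) //; apply: val_inj.
by rewrite (_ : Ordinal h = 1) //; apply: val_inj.
Qed.

Lemma GL2_eq u v : e11 u = e11 v -> e12 u = e12 v -> e21 u = e21 v ->
  e22 u = e22 v -> u = v.
Proof.
move=> h1 h2 h3 h4; apply: val_inj; apply/matrixP.
by apply: ord2P; apply: ord2P.
Qed.

Lemma GL2_mulE u v (i j : 'I_2) :
  GLval (u * v)%g i j =
    GLval u i (0 : 'I_2) * GLval v (0 : 'I_2) j +
    GLval u i (1 : 'I_2) * GLval v (1 : 'I_2) j.
Proof.
rewrite GL_MxE mxE big_ord_recl big_ord1.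
by congr (_ + _ * _); congr (GLval _ _ _); apply: val_inj.
Qed.

Lemma e11M u v : e11 (u * v)%g = e11 u * e11 v + e12 u * e21 v.
Proof. exact: GL2_mulE. Qed.
Lemma e12M u v : e12 (u * v)%g = e11 u * e12 v + e12 u * e22 v.
Proof. exact: GL2_mulE. Qed.
Lemma e21M u v : e21 (u * v)%g = e21 u * e11 v + e22 u * e21 v.
Proof. exact: GL2_mulE. Qed.
Lemma e22M u v : e22 (u * v)%g = e21 u * e12 v + e22 u * e22 v.
Proof. exact: GL2_mulE. Qed.
Lemma e11_1 : e11 1%g = 1. Proof. by rewrite /e11 GL_1E mxE. Qed.
Lemma e12_1 : e12 1%g = 0. Proof. by rewrite /e12 GL_1E mxE. Qed.
Lemma e21_1 : e21 1%g = 0. Proof. by rewrite /e21 GL_1E mxE. Qed.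
Lemma e22_1 : e22 1%g = 1. Proof. by rewrite /e22 GL_1E mxE. Qed.

Definition mulE := (e11M, e12M, e21M, e22M).
Definition oneE := (e11_1, e12_1, e21_1, e22_1).

Lemma det22 (M : 'M[F]_2) : \det M = M 0 0 * M 1 1 - M 0 1 * M 1 0.
Proof.
rewrite (expand_det_row _ 0) big_ord_recl big_ord1 /cofactor !det_mx11 !mxE /=.
have -> : lift 0 0 = 1 :> 'I_2 by apply: val_inj.
have -> : lift 1 0 = 0 :> 'I_2 by apply: val_inj.
by rewrite /= expr0 expr1; ring.
Qed.

Lemma inSLP u : reflect (e11 u * e22 u = 1 + e12 u * e21 u) (u \in SL2).
Proof.
rewrite inE (det22 (GLval u)) -/(e11 u) -/(e12 u) -/(e21 u) -/(e22 u).
by rewrite subr_eq; apply: eqP.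
Qed.

Lemma SL_mk (a b c d : F) : a * d = 1 + b * c ->
  exists2 u, u \in SL2 & [/\ e11 u = a, e12 u = b, e21 u = c & e22 u = d].
Proof.
move=> h.
pose M : 'M[F]_2 := \matrix_(i, j)
  if i == 0 then (if j == 0 then a else b) else (if j == 0 then c else d).
have uM : M \is a GRing.unit.
  by rewrite unitmxE det22 !mxE /= h addrK unitr1.
have [E1 E2 E3 E4] : [/\ e11 (Sub M uM : GL2) = a, e12 (Sub M uM : GL2) = b,
   e21 (Sub M uM : GL2) = c & e22 (Sub M uM : GL2) = d].
  by split; rewrite /e11 /e12 /e21 /e22 /= mxE.
exists (Sub M uM : GL2) => //.
by apply/inSLP; rewrite E1 E2 E3 E4.
Qed.

Lemma SLV u : u \in SL2 ->
  [/\ e11 u^-1%g = e22 u, e12 u^-1%g = - e12 u,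
      e21 u^-1%g = - e21 u & e22 u^-1%g = e11 u].
Proof.
move=> /inSLP h.
have [//| v vS [E1 E2 E3 E4]] := @SL_mk (e22 u) (- e12 u) (- e21 u) (e11 u).
  by rewrite mulrNN mulrC.
suff -> : (u^-1)%g = v by [].
apply/eqP; rewrite eq_invg_mul; apply/eqP; apply: GL2_eq;
  rewrite !mulE !oneE ?E1 ?E2 ?E3 ?E4; ring: h.
Qed.

Lemma tr2C u v : tr2 (u * v)%g = tr2 (v * u)%g.
Proof. by rewrite /tr2 !mulE; ring. Qed.

Lemma tr2J g x : tr2 (x * g * x^-1)%g = tr2 g.
Proof. by rewrite tr2C !mulgA mulVg mul1g. Qed.

Definition scal u := [&& e12 u == 0, e21 u == 0 & e11 u == e22 u].

(** Proportionality of two vectors, as the vanishing of their 2x2 minors; this allows zero vectors,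
    so transitivity needs a nonzero middle term. *)
Definition par (p1 p2 p3 q1 q2 q3 : F) :=
  [/\ p1 * q2 = p2 * q1, p1 * q3 = p3 * q1 & p2 * q3 = p3 * q2].

Lemma parC p1 p2 p3 q1 q2 q3 :
  par p1 p2 p3 q1 q2 q3 -> par q1 q2 q3 p1 p2 p3.
Proof. by case=> h1 h2 h3; split; rewrite mulrC -?h1 -?h2 -?h3 mulrC. Qed.

Lemma par_trans q1 q2 q3 p1 p2 p3 r1 r2 r3 :
  ~~ [&& q1 == 0, q2 == 0 & q3 == 0] ->
  par p1 p2 p3 q1 q2 q3 -> par q1 q2 q3 r1 r2 r3 -> par p1 p2 p3 r1 r2 r3.
Proof.
rewrite !negb_and => /or3P[] nz [h1 h2 h3] [k1 k2 k3]; split; apply: (mulfI nz);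
  apply: (mulfI nz).
- have -> : q1 * (q1 * (p1 * r2)) = (p1 * q1) * (q1 * r2) by ring.
  have -> : q1 * (q1 * (p2 * r1)) = (p2 * q1) * (q1 * r1) by ring.
  by rewrite k1 -h1; ring.
- have -> : q1 * (q1 * (p1 * r3)) = (p1 * q1) * (q1 * r3) by ring.
  have -> : q1 * (q1 * (p3 * r1)) = (p3 * q1) * (q1 * r1) by ring.
  by rewrite k2 -h2; ring.
- have -> : q1 * (q1 * (p2 * r3)) = (p2 * q1) * (q1 * r3) by ring.
  have -> : q1 * (q1 * (p3 * r2)) = (p3 * q1) * (q1 * r2) by ring.
  by rewrite k2 -h2 k1 -h1; ring.
- have -> : q2 * (q2 * (p1 * r2)) = (p1 * q2) * (q2 * r2) by ring.
  have -> : q2 * (q2 * (p2 * r1)) = (p2 * q2) * (q2 * r1) by ring.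
  by rewrite -k1 h1; ring.
- have -> : q2 * (q2 * (p1 * r3)) = (p1 * q2) * (q2 * r3) by ring.
  have -> : q2 * (q2 * (p3 * r1)) = (p3 * q2) * (q2 * r1) by ring.
  by rewrite -k1 h1 k3 -h3; ring.
- have -> : q2 * (q2 * (p2 * r3)) = (p2 * q2) * (q2 * r3) by ring.
  have -> : q2 * (q2 * (p3 * r2)) = (p3 * q2) * (q2 * r2) by ring.
  by rewrite k3 -h3; ring.
- have -> : q3 * (q3 * (p1 * r2)) = (p1 * q3) * (q3 * r2) by ring.
  have -> : q3 * (q3 * (p2 * r1)) = (p2 * q3) * (q3 * r1) by ring.
  by rewrite -k3 -k2 h2 h3; ring.
- have -> : q3 * (q3 * (p1 * r3)) = (p1 * q3) * (q3 * r3) by ring.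
  have -> : q3 * (q3 * (p3 * r1)) = (p3 * q3) * (q3 * r1) by ring.
  by rewrite -k2 h2; ring.
- have -> : q3 * (q3 * (p2 * r3)) = (p2 * q3) * (q3 * r3) by ring.
  have -> : q3 * (q3 * (p3 * r2)) = (p3 * q3) * (q3 * r2) by ring.
  by rewrite -k3 h3; ring.
Qed.

(** [e12], [e21] and [e11 - e22] are coordinates on matrices modulo scalar matrices. *)
Definition gpar u v :=
  par (e12 u) (e21 u) (e11 u - e22 u) (e12 v) (e21 v) (e11 v - e22 v).

Lemma commuteP u v : commute u v <-> gpar u v.
Proof.
split=> [h|[h1 h2 h3]].
  have E1 : e11 (u * v)%g = e11 (v * u)%g by rewrite h.
  have E2 : e12 (u * v)%g = e12 (v * u)%g by rewrite h.
  have E3 : e21 (u * v)%g = e21 (v * u)%g by rewrite h.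
  rewrite !mulE in E1 E2 E3; split; apply/eqP; rewrite -subr_eq0; apply/eqP.
  - by move/eqP: E1; rewrite -subr_eq0 => /eqP <-; ring.
  - by move/eqP: E2; rewrite -subr_eq0 => /eqP E; rewrite -[RHS]oppr0 -E; ring.
  - by move/eqP: E3; rewrite -subr_eq0 => /eqP <-; ring.
apply: GL2_eq; rewrite !mulE; apply/eqP; rewrite -subr_eq0; apply/eqP.
- by move/eqP: h1; rewrite -subr_eq0 => /eqP <-; ring.
- by move/eqP: h2; rewrite -subr_eq0 => /eqP E; rewrite -[RHS]oppr0 -E; ring.
- by move/eqP: h3; rewrite -subr_eq0 => /eqP <-; ring.
- by move/eqP: h1; rewrite -subr_eq0 => /eqP E; rewrite -[RHS]oppr0 -E; ring.
Qed.

Lemma scalE u :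
  scal u = [&& e12 u == 0, e21 u == 0 & e11 u - e22 u == 0].
Proof. by rewrite /scal subr_eq0. Qed.

(** The centralizer of a nonscalar matrix depends only on the line that the matrix spans modulo
    scalars. *)
Lemma cent1_eq g h : ~~ scal g -> ~~ scal h -> h \in 'C[g]%g -> ('C[h] = 'C[g])%g.
Proof.
rewrite !scalE => ng nh /cent1P /commuteP gh.
by apply/setP => x; apply/cent1P/cent1P => /commuteP p; apply/commuteP;
  [apply: par_trans nh p _ | apply: par_trans ng p _; apply: parC].
Qed.

Lemma par_scale p1 p2 p3 q1 q2 q3 : ~~ [&& q1 == 0, q2 == 0 & q3 == 0] ->
  par p1 p2 p3 q1 q2 q3 ->
  exists b, [/\ p1 = b * q1, p2 = b * q2 & p3 = b * q3].
Proof.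
rewrite !negb_and => /or3P[] nz [h1 h2 h3].
- exists (p1 / q1); split; apply: (mulIf nz); first by rewrite divfK.
  + by rewrite -h1 mulrAC divfK.
  + by rewrite -h2 mulrAC divfK.
- exists (p2 / q2); split; apply: (mulIf nz); last by rewrite mulrAC divfK.
  + by rewrite h1 mulrAC divfK.
  + by rewrite divfK.
- exists (p3 / q3); split; apply: (mulIf nz); last by rewrite divfK.
  + by rewrite h2 mulrAC divfK.
  + by rewrite h3 mulrAC divfK.
Qed.

Lemma cent1_lin g x : ~~ scal g -> x \in 'C[g]%g ->
  exists ab : F * F, [/\ e11 x = ab.1 + ab.2 * e11 g, e12 x = ab.2 * e12 g,
     e21 x = ab.2 * e21 g & e22 x = ab.1 + ab.2 * e22 g].
Proof.
rewrite scalE => ng /cent1P /commuteP /(par_scale ng) [b [B1 B2 B3]].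
exists (e11 x - b * e11 g, b) => /=; split=> //; first by ring.
by rewrite -[LHS](subKr (e11 x)) B3; ring.
Qed.

End Entries.

(** * Tori *)

Section Tori.
Variable F : finFieldType.
Hypothesis two_neq0 : (2 : F) != 0.
Implicit Types u v g h x d : GL2 F.
Local Notation SL2 := (SL2 F).

Lemma four_neq0 : (4 : F) != 0.
Proof.
have -> : (4 : F) = 2 * 2 by ring.
by rewrite mulf_neq0.
Qed.

(** For determinant 1 the characteristic polynomial has discriminant [tr2 g ^+ 2 - 4], so the
    eigenvalues are distinct. *)
Definition regular g := tr2 g ^+ 2 != 4.

Definition lin g (a b : F) x :=
  [/\ e11 x = a + b * e11 g, e12 x = b * e12 g,
      e21 x = b * e21 g & e22 x = a + b * e22 g].

Lemma detE u : u \in SL2 -> e12 u * e21 u = e11 u * e22 u - 1.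
Proof. by move=> /inSLP ->; ring. Qed.

(** The quadratic relation says that det (a + b g) = a^2 + a b tr(g) + b^2 equals 1. *)
Lemma cent1_linSL g x : g \in SL2 -> x \in SL2 -> ~~ scal g -> x \in 'C[g]%g ->
  exists a b, lin g a b x /\ a ^+ 2 = 1 - a * b * tr2 g - b ^+ 2.
Proof.
move=> gS xS ng /(cent1_lin ng) [[a b] /= l]; exists a, b; split=> //.
case: l => l1 l2 l3 l4; move: (detE xS); rewrite l1 l2 l3 l4 /tr2.
move/eqP; rewrite -subr_eq0 => /eqP E; apply/eqP; rewrite -subr_eq0; apply/eqP.
rewrite -[RHS]oppr0 -E; ring: (detE gS).
Qed.

Lemma lin_scal g a b x : lin g a b x -> ~~ scal x -> b != 0.
Proof.
case=> l1 l2 l3 l4; apply: contra => /eqP b0.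
by rewrite /scal l1 l2 l3 l4 b0 !mul0r !addr0 !eqxx.
Qed.

Lemma lin_disc g a b x : lin g a b x -> a ^+ 2 = 1 - a * b * tr2 g - b ^+ 2 ->
  tr2 x ^+ 2 - 4 = b ^+ 2 * (tr2 g ^+ 2 - 4).
Proof.
case=> l1 l2 l3 l4 E.
have -> : tr2 x = 2 * a + b * tr2 g by rewrite /tr2 l1 l4; ring.
ring: E.
Qed.

Lemma regular_nscal g : g \in SL2 -> regular g -> ~~ scal g.
Proof.
move=> gS; apply: contra => /and3P[/eqP h1 /eqP h2 /eqP h3].
have := detE gS; rewrite /tr2 h1 h3 mul0r => /eqP.
by rewrite eq_sym subr_eq0 => /eqP E; apply/eqP; ring: E.
Qed.

Lemma regular_cent g h : g \in SL2 -> h \in SL2 -> regular g ->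
  h \in 'C[g]%g -> ~~ scal h -> regular h.
Proof.
move=> gS hS rg hC nh.
have [a [b [l E]]] := cent1_linSL gS hS (regular_nscal gS rg) hC.
rewrite /regular -subr_eq0 (lin_disc l E) mulf_neq0 ?expf_neq0 //.
  exact: (lin_scal l nh).
by rewrite subr_eq0; apply: rg.
Qed.

(** The trace gives the pair of eigenvalues, hence the element up to exchanging them. Concretely,
    [lin_disc] determines [b ^+ 2], and the two signs of [b] give mutually inverse elements. *)
Lemma cent_tr_eq g h k : g \in SL2 -> h \in SL2 -> k \in SL2 -> regular g ->
  h \in 'C[g]%g -> k \in 'C[g]%g -> tr2 h = tr2 k -> k = h \/ k = (h^-1)%g.
Proof.
move=> gS hS kS rg hC kC e.
have ng := regular_nscal gS rg.
have [a [b [l E]]] := cent1_linSL gS hS ng hC.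
have [a' [b' [l' E']]] := cent1_linSL gS kS ng kC.
have : b ^+ 2 = b' ^+ 2.
  apply: (@mulIf _ (tr2 g ^+ 2 - 4)); first by rewrite subr_eq0; apply: rg.
  by rewrite -(lin_disc l E) -(lin_disc l' E') e.
have [hV1 hV2 hV3 hV4] := SLV hS.
move: l l' e; rewrite /lin /tr2 => -[l1 l2 l3 l4] [m1 m2 m3 m4].
rewrite l1 l4 m1 m4 => e /eqP; rewrite eqf_sqr => /orP[] /eqP bb; [left|right].
  have aa : a = a'.
    apply: (mulfI two_neq0); apply: (@addIr _ (b * e11 g + b * e22 g)).
    by transitivity (a + b * e11 g + (a + b * e22 g)); [ring | rewrite e bb; ring].
  by apply: GL2_eq; rewrite ?l1 ?l2 ?l3 ?l4 ?m1 ?m2 ?m3 ?m4 ?aa ?bb.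
have aa : a' = a + b * (e11 g + e22 g).
  apply: (mulfI two_neq0); apply: (@addIr _ (b' * e11 g + b' * e22 g)).
  by transitivity (a' + b' * e11 g + (a' + b' * e22 g)); [ring | rewrite -e bb; ring].
have {}bb : b' = - b by rewrite bb opprK.
by apply: GL2_eq; rewrite ?hV1 ?hV2 ?hV3 ?hV4 ?l1 ?l2 ?l3 ?l4 ?m1 ?m2 ?m3 ?m4 ?aa
  ?bb; ring.
Qed.

(* A function on the double cosets of the torus [C(g)]. *)
Definition inv_form g h : F := tr2 (g * h * g * h^-1)%g.

Lemma inv_formM g d1 d2 h : d1 \in 'C[g]%g -> d2 \in 'C[g]%g ->
  inv_form g (d1 * h * d2)%g = inv_form g h.
Proof.
move=> /cent1P c1 /cent1P c2; rewrite /inv_form -[RHS](tr2J _ d1); congr tr2.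
rewrite !invMg !mulgA c1 -!mulgA; congr (_ * (_ * (_ * _)))%g.
by rewrite !mulgA c2 mulgK.
Qed.

(** With h = x g x^-1, this is det (g h - h g) written through traces; it vanishes exactly when g
    and h share an eigenline over an algebraic closure. *)
Definition kappa g x : F :=
  let s := tr2 (g * (x * g * x^-1))%g in - (s - 2) * (s - tr2 g ^+ 2 + 2).

Lemma linJ g a b d x : x \in SL2 -> lin g a b d ->
  lin (x * g * x^-1)%g a b (x * d * x^-1)%g.
Proof.
move=> xS [l1 l2 l3 l4]; have [v1 v2 v3 v4] := SLV xS; have D := detE xS.
by split; rewrite !mulE ?v1 ?v2 ?v3 ?v4 ?l1 ?l2 ?l3 ?l4; ring: D.
Qed.

(** When [kappa g x] is nonzero, [inv_form] on the conjugated torus thus determines [b ^+ 2]. *)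
Lemma inv_form_torus g d x a b : g \in SL2 -> d \in SL2 -> x \in SL2 ->
  lin g a b d -> a ^+ 2 = 1 - a * b * tr2 g - b ^+ 2 ->
  inv_form g (x * d * x^-1)%g = tr2 g ^+ 2 - 2 + kappa g x * b ^+ 2.
Proof.
move=> gS dS xS /(linJ xS).
have: (x * d * x^-1)%g \in SL2 by rewrite !groupM ?groupV.
have: (x * g * x^-1)%g \in SL2 by rewrite !groupM ?groupV.
move: (tr2J g x); rewrite /inv_form /kappa.
move: (x * d * x^-1)%g (x * g * x^-1)%g => M g' e g'S MS l E.
have [v1 v2 v3 v4] := SLV MS; have D := detE gS; have D' := detE g'S.
case: l => l1 l2 l3 l4.
have e' : e22 g' = e11 g + e22 g - e11 g' by move: e; rewrite /tr2 => <-; ring.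
move: E D'; rewrite /tr2 !mulE v1 v2 v3 v4 l1 l2 l3 l4 e' => E D'.
ring: D D' E.
Qed.

End Tori.

(** * Irreducibility and escape *)

Section Generic.
Variable F : finFieldType.
Hypothesis two_neq0 : (2 : F) != 0.
Implicit Types u v g h x d w : GL2 F.
Local Notation SL2 := (SL2 F).
Local Notation q := #|F|.

(** Otherwise tr(uv) and tr(uv^-1) have squares 4 and their sum tr(u) tr(v) has square 16, so they
    are equal. The discriminant form then vanishes on the span of u and v modulo scalars; a
    nondegenerate ternary form has no isotropic plane, so u and v commute. *)
Lemma exists_regular u v : u \in SL2 -> v \in SL2 -> v \notin 'C[u]%g ->
  exists2 z, z \in [:: u; v; u * v; u * v^-1]%g & regular z.
Proof.
move=> uS vS nC; apply/hasP; apply: contraR nC => /=.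
rewrite !negb_or !negbK => /and5P[/eqP hu /eqP hv /eqP huv /eqP huV _].
have [v1 v2 v3 v4] := SLV vS.
have sumE : tr2 (u * v)%g + tr2 (u * v^-1)%g = tr2 u * tr2 v.
  by rewrite /tr2 !mulE v1 v2 v3 v4; ring.
have prodE : tr2 (u * v)%g * tr2 (u * v^-1)%g = 4.
  apply: (mulfI two_neq0).
  transitivity ((tr2 (u * v)%g + tr2 (u * v^-1)%g) ^+ 2 - tr2 (u * v)%g ^+ 2
    - tr2 (u * v^-1)%g ^+ 2); first by ring.
  by rewrite sumE huv huV exprMn hu hv; ring.
have eqE : tr2 (u * v)%g = tr2 (u * v^-1)%g.
  apply/eqP; rewrite -subr_eq0 -sqrf_eq0; apply/eqP.
  transitivity (tr2 (u * v)%g ^+ 2 + tr2 (u * v^-1)%g ^+ 2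
    - 2 * (tr2 (u * v)%g * tr2 (u * v^-1)%g)); first by ring.
  by rewrite huv huV prodE; ring.
have D := detE uS; have D' := detE vS.
pose x := e11 u - e22 u; pose x' := e11 v - e22 v.
have qu : x ^+ 2 = - 4 * (e12 u * e21 u).
  by apply: (@addIr _ (- tr2 u ^+ 2)); rewrite {2}hu D /x /tr2; ring.
have qv : x' ^+ 2 = - 4 * (e12 v * e21 v).
  by apply: (@addIr _ (- tr2 v ^+ 2)); rewrite {2}hv D' /x' /tr2; ring.
have quv : x * x' = - 2 * (e12 u * e21 v + e21 u * e12 v).
  apply/eqP; rewrite -subr_eq0; apply/eqP.
  transitivity (tr2 (u * v)%g - tr2 (u * v^-1)%g); last by rewrite eqE subrr.
  by rewrite /x /x' /tr2 !mulE v1 v2 v3 v4; ring.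
apply/cent1P/commute_sym/commuteP; rewrite /gpar -/x -/x'.
have sq0 (r s : F) : (r - s) ^+ 2 = 0 -> r = s.
  by move=> /eqP; rewrite sqrf_eq0 subr_eq0 => /eqP.
split; apply: sq0.
- apply: (mulfI (four_neq0 two_neq0)); rewrite mulr0.
  transitivity ((- 2 * (e12 u * e21 v + e21 u * e12 v)) ^+ 2
     - (- 4 * (e12 u * e21 u)) * (- 4 * (e12 v * e21 v))); first by ring.
  by rewrite -quv -qu -qv; ring.
- transitivity (e12 u ^+ 2 * x' ^+ 2 + e12 v ^+ 2 * x ^+ 2
     - 2 * (x * x') * (e12 u * e12 v)); first by ring.
  by rewrite quv qu qv; ring.
- transitivity (e21 u ^+ 2 * x' ^+ 2 + e21 v ^+ 2 * x ^+ 2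
     - 2 * (x * x') * (e21 u * e21 v)); first by ring.
  by rewrite quv qu qv; ring.
Qed.

(* [pair x y z w] is the trace of [w] against the traceless matrix
   [[x, y], [z, -x]]. *)
Definition pair (x y z : F) w := x * (e11 w - e22 w) + y * e21 w + z * e12 w.

Lemma exists_e21 g : g \in SL2 -> ~~ scal g ->
  exists2 h, h \in SL2 & e21 (h * g * h^-1)%g != 0.
Proof.
move=> gS ng; have [c0|c0] := eqVneq (e21 g) 0; last first.
  by exists 1%g; rewrite ?group1 // invg1 mulg1 mul1g.
have [b0|b0] := eqVneq (e12 g) 0; last first.
  have [|h hS [E1 E2 E3 E4]] := @SL_mk F 0 1 (-1) 0; first by ring.
  have [v1 v2 v3 v4] := SLV hS; exists h => //.
  rewrite !mulE v1 v3 ?E1 ?E2 ?E3 ?E4.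
  set t := (X in X != 0); have -> : t = - e12 g by rewrite /t; ring.
  by rewrite oppr_eq0.
have [|h hS [E1 E2 E3 E4]] := @SL_mk F 1 0 1 1; first by ring.
have [v1 v2 v3 v4] := SLV hS; exists h => //.
rewrite !mulE v1 v3 ?E1 ?E2 ?E3 ?E4 b0 c0.
set t := (X in X != 0); have -> : t = e11 g - e22 g by rewrite /t; ring.
by apply: contra ng; rewrite subr_eq0 /scal b0 c0 !eqxx.
Qed.

(** Irreducibility of the adjoint representation. Conjugate an element with [e21] nonzero by the
    unipotents of parameter 0, 1 and -1: a second difference kills [z], a first difference then
    kills [x], and the value at 0 kills [y]. *)
Lemma adjoint_irr g (x y z : F) : g \in SL2 -> ~~ scal g ->
  (forall h, h \in SL2 -> pair x y z (h * g * h^-1)%g = 0) ->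
  [/\ x = 0, y = 0 & z = 0].
Proof.
move=> gS ng H.
have [h hS] := exists_e21 gS ng.
have [|u uS [E1 E2 E3 E4]] := @SL_mk F 1 1 0 1; first by ring.
have [|u' uS' [E1' E2' E3' E4']] := @SL_mk F 1 (-1) 0 1; first by ring.
have [v1 v2 v3 v4] := SLV uS; have [v1' v2' v3' v4'] := SLV uS'.
have := H _ hS; have := H _ (groupM uS hS); have := H _ (groupM uS' hS).
have Hc k : (k * h * g * (k * h)^-1 = k * (h * g * h^-1) * k^-1)%g.
  by rewrite invMg !mulgA.
rewrite !Hc; move: (h * g * h^-1)%g => w.
rewrite /pair !mulE v1 v2 v3 v4 v1' v2' v3' v4' E1 E2 E3 E4 E1' E2' E3' E4'.
move=> P1 P2 P3 w0.
have z0 : z = 0.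
  apply: (mulIf w0); apply: (mulfI two_neq0); rewrite mul0r mulr0.
  have E (L1 L2 L3 : F) : L1 = 0 -> L2 = 0 -> L3 = 0 -> - (L1 + L2 - 2 * L3) = 0.
    by move=> -> -> ->; ring.
  by rewrite -(E _ _ _ P1 P2 P3); ring.
have x0 : x = 0.
  apply: (mulIf w0); apply: (mulfI two_neq0); rewrite mul0r mulr0.
  have E (L1 L2 : F) : L1 = 0 -> L2 = 0 -> L1 - L2 = 0.
    by move=> -> ->; ring.
  by rewrite -(E _ _ P2 P3) z0; ring.
by split=> //; apply: (mulIf w0); rewrite mul0r -P3 x0 z0; ring.
Qed.

(* Entries (11, 12, 21) of the opposite of the commutator [g h - h g], which spans
   the orthogonal of [1, g, h] for the trace form. *)
Definition crs g h : F * F * F :=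
  (e21 g * e12 h - e12 g * e21 h,
   e12 g * (e11 h - e22 h) - (e11 g - e22 g) * e12 h,
   (e11 g - e22 g) * e21 h - e21 g * (e11 h - e22 h)).

Lemma crs_kappa g x : g \in SL2 -> x \in SL2 ->
  let n := crs g (x * g * x^-1)%g in
  n.1.1 ^+ 2 + n.1.2 * n.2 = - kappa g x.
Proof.
move=> gS xS; have: (x * g * x^-1)%g \in SL2 by rewrite !groupM ?groupV.
rewrite /kappa; move: (tr2J g x); move: (x * g * x^-1)%g => h e hS; move: e.
rewrite /crs /tr2 /= !mulE; have D := detE gS; have D' := detE hS.
move=> e; have {}e : e22 h = e11 g + e22 g - e11 h by rewrite -e; ring.
rewrite e in D' *; ring: D D'.
Qed.

(* Prescribing [tr], [tr (g _)] and [tr (h _)] cuts out a line, which meets the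
   quadric [det = 1] at most twice as its direction is not isotropic. *)
Lemma trace_fiber g h s0 s1 s2 : (let n := crs g h in n.1.1 ^+ 2 + n.1.2 * n.2 != 0) ->
  s0 \in SL2 -> s1 \in SL2 -> s2 \in SL2 ->
  tr2 s1 = tr2 s0 -> tr2 s2 = tr2 s0 ->
  tr2 (g * s1)%g = tr2 (g * s0)%g -> tr2 (g * s2)%g = tr2 (g * s0)%g ->
  tr2 (h * s1)%g = tr2 (h * s0)%g -> tr2 (h * s2)%g = tr2 (h * s0)%g ->
  s1 != s0 -> s2 != s0 -> s1 = s2.
Proof.
rewrite /crs /=; set N1 := _ - _; set N2 := _ - _; set N3 := _ - _.
move=> Q0 S0 S1 S2 t1 t2 g1 g2 h1 h2 n1 n2.
have nN : ~~ [&& N1 == 0, N2 == 0 & N3 == 0].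
  by apply: contra Q0 => /and3P[/eqP-> /eqP-> _]; rewrite mul0r addr0 expr0n.
have D0 := detE S0.
have comb0 (c d L M : F) : L = 0 -> M = 0 -> c * L + d * M = 0.
  by move=> -> ->; ring.
have key s : s \in SL2 -> tr2 s = tr2 s0 -> tr2 (g * s)%g = tr2 (g * s0)%g ->
   tr2 (h * s)%g = tr2 (h * s0)%g -> s != s0 ->
   exists l, [/\ l != 0, e11 s = e11 s0 + l * N1, e12 s = e12 s0 + l * N2,
     e21 s = e21 s0 + l * N3 & e22 s = e22 s0 - l * N1] /\
     l * (N1 ^+ 2 + N2 * N3) =
       e22 s0 * N1 - e11 s0 * N1 - e12 s0 * N3 - e21 s0 * N2.
  move=> sS t gg hh ns; have Ds := detE sS.
  pose X := e11 s - e11 s0; pose Y := e12 s - e12 s0; pose Z := e21 s - e21 s0.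
  have E4 : e22 s = e22 s0 - X.
    by rewrite /X; move: t; rewrite /tr2 => t;
      transitivity (e11 s + e22 s - e11 s); [ring | rewrite t; ring].
  have Pg : X * (e11 g - e22 g) + e12 g * Z + e21 g * Y = 0.
    apply: (@addIr _ (tr2 (g * s0)%g)); rewrite add0r -{2}gg /tr2 !mulE E4 /X /Y /Z; ring.
  have Ph : X * (e11 h - e22 h) + e12 h * Z + e21 h * Y = 0.
    apply: (@addIr _ (tr2 (h * s0)%g)); rewrite add0r -{2}hh /tr2 !mulE E4 /X /Y /Z; ring.
  have [||l [l1 l2 l3]] := @par_scale F X Y Z N1 N2 N3; first exact: nN.
    split; apply/eqP; rewrite -subr_eq0; apply/eqP.
    - by rewrite -(comb0 (e12 g) (- e12 h) _ _ Ph Pg) /N1 /N2 /N3; ring.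
    - by rewrite -(comb0 (e21 h) (- e21 g) _ _ Pg Ph) /N1 /N2 /N3; ring.
    - by rewrite -(comb0 (e11 g - e22 g) (- (e11 h - e22 h)) _ _ Ph Pg) /N1 /N2 /N3; ring.
  have F1 : e11 s = e11 s0 + l * N1 by rewrite -l1 /X; ring.
  have F2 : e12 s = e12 s0 + l * N2 by rewrite -l2 /Y; ring.
  have F3 : e21 s = e21 s0 + l * N3 by rewrite -l3 /Z; ring.
  have F4 : e22 s = e22 s0 - l * N1 by rewrite E4 l1.
  have ln : l != 0.
    apply: contra ns => /eqP l0.
    by apply/eqP/GL2_eq; rewrite ?F1 ?F2 ?F3 ?F4 l0 mul0r ?subr0 ?addr0.
  exists l; split; first by split.
  (* The two determinant equations differ by [l] times an expression linear in [l]; cancelling [l]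
     determines it. *)
  apply: (mulfI ln); apply/eqP; rewrite -subr_eq0; apply/eqP.
  transitivity (e12 s * e21 s - (e11 s * e22 s - 1)
     - (e12 s0 * e21 s0 - (e11 s0 * e22 s0 - 1))).
    by rewrite F1 F2 F3 F4; ring.
  by rewrite Ds D0; ring.
have [l [[_ a1 a2 a3 a4] al]] := key _ S1 t1 g1 h1 n1.
have [m [[_ b1 b2 b3 b4] bl]] := key _ S2 t2 g2 h2 n2.
have lm : l = m by apply: (mulIf Q0); rewrite al bl.
by apply: GL2_eq; rewrite ?a1 ?a2 ?a3 ?a4 ?b1 ?b2 ?b3 ?b4 lm.
Qed.

End Generic.

(** * Sizes of tori and of SL_2, and spans modulo scalars *)

Section Cards.
Variable F : finFieldType.
Hypothesis two_neq0 : (2 : F) != 0.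
Implicit Types u v g h x d w : GL2 F.
Local Notation SL2 := (SL2 F).
Local Notation q := #|F|.

(** An element a + b g of the torus is known from [b] up to the two roots [a] of a quadratic
    equation. *)
Lemma card_torus g : g \in SL2 -> ~~ scal g -> (#|SL2 :&: 'C[g]%g| <= 2 * q)%N.
Proof.
move=> gS ng.
(* A coordinate modulo scalars that does not vanish at [g] reads off [b]. *)
have [f fg fl] : exists2 f : GL2 F -> F, f g != 0 &
    forall a b x, lin g a b x -> f x = b * f g.
  move: ng; rewrite scalE !negb_and => /or3P[] nz.
  - by exists (@e12 F) => // a b x [].
  - by exists (@e21 F) => // a b x [].
  - by exists (fun x => e11 x - e22 x) => // a b x [-> _ _ ->]; ring.
have -> : q = #|[set: F]| by rewrite cardsT.
apply: (@leq_card_fibers _ _ _ _ f) => [x _|d]; first by rewrite inE.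
rewrite in_setI => /andP[dS dC]; apply: card_le2 => x y z.
have [a [b [l E]]] := cent1_linSL gS dS ng dC.
have key w : w \in [set x' in SL2 :&: 'C[g]%g | f x' == f d] ->
   exists2 c, lin g c b w & c ^+ 2 = 1 - c * b * tr2 g - b ^+ 2.
  rewrite in_set in_setI => /andP[/andP[wS wC] /eqP e].
  have [c [b' [l' E']]] := cent1_linSL gS wS ng wC.
  have bb : b' = b by apply: (mulIf fg); rewrite -(fl _ _ _ l) -(fl _ _ _ l').
  by rewrite -bb; exists c.
move=> /key[c1 l1 E1] /key[c2 l2 E2] /key[c3 l3 E3].
have lin_eq c c' w w' : lin g c b w -> lin g c' b w' -> c = c' -> w = w'.
  by move=> [h1 h2 h3 h4] [k1 k2 k3 k4] cc;
    apply: GL2_eq; rewrite ?h1 ?h2 ?h3 ?h4 ?k1 ?k2 ?k3 ?k4 ?cc.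
have root c w : lin g c b w -> c ^+ 2 = 1 - c * b * tr2 g - b ^+ 2 ->
    w != x -> c = - b * tr2 g - c1.
  move=> l' E' ne; have ne' : c - c1 != 0.
    by apply: contra ne; rewrite subr_eq0 => /eqP cc; apply/eqP; apply: lin_eq l' l1 cc.
  apply: (mulfI ne'); apply/eqP; rewrite -subr_eq0; apply/eqP.
  transitivity (c ^+ 2 - c1 ^+ 2 + (c - c1) * b * tr2 g); first by ring.
  by rewrite E' E1; ring.
move=> /(root _ _ l2 E2) r2 /(root _ _ l3 E3) r3.
by apply: (lin_eq _ _ _ _ l2 l3); rewrite r2 r3.
Qed.

Lemma card_SL2_ge : (q ^ 2 * q.-1 <= #|SL2|)%N.
Proof.
have -> : (q ^ 2 * q.-1)%N = #|setX [set~ (0 : F)] [set: F * F]|.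
  by rewrite cardsX cardsC1 cardsT card_prod mulnC mulnn.
apply: leq_trans (leq_imset_card (fun u => (e11 u, (e12 u, e21 u))) SL2).
apply: subset_leq_card; apply/subsetP => -[a [b c]]; rewrite !inE /= andbT => a0.
have [|u uS [E1 E2 E3 E4]] := @SL_mk F a b c ((1 + b * c) / a).
  by rewrite mulrC divfK.
by apply/imsetP; exists u => //; rewrite E1 E2 E3.
Qed.

Lemma card_SL2_le : (#|SL2| <= q ^ 3)%N.
Proof.
have -> : (q ^ 3)%N = #|[set:
  F * F * F]| by rewrite cardsT !card_prod !expnS expn0 muln1 mulnA.
apply: (@card_leq_inj _ _ _ _
  (* When [e11] vanishes, [e12] is invertible and determines [e21], while [e22] becomes free. *)
  (fun u => (e11 u, e12 u, if e11 u == 0 then e22 u else e21 u))) => // u v.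
move=> uS vS [h1 h2]; rewrite h1; have := detE uS; have := detE vS.
case: eqP => [a0|/eqP a0] D D' h3.
  rewrite h1 h2 a0 !mul0r !sub0r in D D'.
  have b0 : e12 v != 0.
    by apply: contra_eq_neq D => ->; rewrite mul0r eq_sym oppr_eq0 oner_eq0.
  by apply: GL2_eq => //; apply: (mulfI b0); rewrite D D'.
apply: GL2_eq => //; apply: (mulfI a0); apply: (@addIr _ (-1)).
by rewrite -D -{1}h1 -D' h2 h3.
Qed.

Lemma tr2_mulJ g x y :
  tr2 ((x * g * x^-1) * (y * g * y^-1))%g =
  tr2 (g * ((x^-1 * y) * g * (x^-1 * y)^-1))%g.
Proof.
rewrite -[RHS](tr2J _ x); congr tr2.
by rewrite !invMg invgK !mulgA mulgK.
Qed.

Lemma pairJ_lin g h x (n1 n2 n3 : F) w (b c : F) : x \in SL2 ->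
  e12 w = b * e12 g + c * e12 h -> e21 w = b * e21 g + c * e21 h ->
  e11 w - e22 w = b * (e11 g - e22 g) + c * (e11 h - e22 h) ->
  pair n1 n2 n3 (x * w * x^-1)%g =
    b * pair n1 n2 n3 (x * g * x^-1)%g + c * pair n1 n2 n3 (x * h * x^-1)%g.
Proof.
move=> xS h1 h2 h3; have [v1 v2 v3 v4] := SLV xS.
have h4 : e11 w = e22 w + (b * (e11 g - e22 g) + c * (e11 h - e22 h)).
  by rewrite -h3; ring.
by rewrite /pair !mulE ?v1 ?v2 ?v3 ?v4 h4 h1 h2; ring.
Qed.

(** The orthogonal of the nonzero vector [crs g h] is a plane, hence spanned by [g] and [h] modulo
    scalars; the coefficients come from Cramer's rule. *)
Lemma crs_span g h w : let n := crs g h in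
  ~~ [&& n.1.1 == 0, n.1.2 == 0 & n.2 == 0] ->
  pair n.1.1 n.1.2 n.2 w = 0 ->
  exists bc : F * F, [/\ e12 w = bc.1 * e12 g + bc.2 * e12 h,
    e21 w = bc.1 * e21 g + bc.2 * e21 h &
    e11 w - e22 w = bc.1 * (e11 g - e22 g) + bc.2 * (e11 h - e22 h)].
Proof.
rewrite /crs /pair /=; set N1 := _ - _; set N2 := _ - _; set N3 := _ - _.
have divMK (m c d : F) : m != 0 -> c / m * d * m = c * d.
  by move=> m0; rewrite mulrAC divfK.
rewrite !negb_and => /or3P[] nz P.
- exists ((e21 w * e12 h - e12 w * e21 h) / N1, (e21 g * e12 w - e12 g * e21 w) / N1).
  split; apply: (mulIf nz); rewrite /= [RHS]mulrDl !divMK //.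
  + by rewrite /N1; ring.
  + by rewrite /N1; ring.
  + apply/eqP; rewrite -subr_eq0; apply/eqP; rewrite -P /N1 /N2 /N3; ring.
- exists ((e12 w * (e11 h - e22 h) - (e11 w - e22 w) * e12 h) / N2,
          (e12 g * (e11 w - e22 w) - (e11 g - e22 g) * e12 w) / N2).
  split; apply: (mulIf nz); rewrite /= [RHS]mulrDl !divMK //.
  + by rewrite /N2; ring.
  + apply/eqP; rewrite -subr_eq0; apply/eqP; rewrite -P /N1 /N2 /N3; ring.
  + by rewrite /N2; ring.
- exists (((e11 w - e22 w) * e21 h - e21 w * (e11 h - e22 h)) / N3,
          ((e11 g - e22 g) * e21 w - e21 g * (e11 w - e22 w)) / N3).
  split; apply: (mulIf nz); rewrite /= [RHS]mulrDl !divMK //.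
  + apply/eqP; rewrite -subr_eq0; apply/eqP; rewrite -P /N1 /N2 /N3; ring.
  + by rewrite /N3; ring.
  + by rewrite /N3; ring.
Qed.

End Cards.

(** * Escape from common eigenlines *)

Section Escape.
Variable F : finFieldType.
Hypothesis two_neq0 : (2 : F) != 0.
Implicit Types u v g h x d w : GL2 F.
Local Notation SL2 := (SL2 F).
Local Notation q := #|F|.
Variable A : {set GL2 F}.
Hypotheses (A1 : 1%g \in A) (AV : (A^-1 = A)%g) (genA : <<A>>%g = SL2).

Lemma ballS i x : x \in (A ^+ i)%g -> x \in SL2.
Proof. by rewrite -genA; apply: subsetP; apply: ball_gen. Qed.

Lemma ball1 x : x \in A -> x \in (A ^+ 1)%g. Proof. by rewrite expg1. Qed.

Lemma SLJ g x : g \in SL2 -> x \in SL2 -> (x * g * x^-1)%g \in SL2.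
Proof. by move=> gS xS; rewrite !groupM ?groupV. Qed.

Lemma conjM a x g : ((a * x) * g * (a * x)^-1 = a * (x * g * x^-1) * a^-1)%g.
Proof. by rewrite invMg !mulgA. Qed.

Lemma cent_conj g h x : h \in 'C[g]%g -> (x * h * x^-1)%g \in 'C[x * g * x^-1]%g.
Proof.
move/cent1P => c; apply/cent1P; rewrite /commute.
by rewrite !mulgA !mulgKV -!(mulgA x) -!mulgA (mulgA h) c !mulgA.
Qed.

Lemma scalJ g x : x \in SL2 -> scal (x * g * x^-1)%g = scal g.
Proof.
have main k y : y \in SL2 -> scal k -> scal (y * k * y^-1)%g.
  move=> yS /and3P[/eqP h1 /eqP h2 /eqP h3].
  have -> : (y * k * y^-1 = k)%g; last by rewrite /scal h1 h2 h3 !eqxx.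
  apply: (@mulIg _ y); rewrite mulgKV; apply/commuteP.
  by rewrite /gpar h1 h2 h3 subrr; split; rewrite ?mulr0 ?mul0r.
move=> xS; apply/idP/idP => [|]; last exact: main.
move/(main _ (x^-1)%g); rewrite groupV => /(_ xS).
by rewrite invgK !mulgA mulVg mul1g mulgKV.
Qed.

(** Otherwise all conjugates of [g] lie in the span of 1 and [g], and a nonzero functional killing
    [g] contradicts [adjoint_irr]. *)
Lemma exists_noncommuting g : g \in SL2 -> ~~ scal g ->
  exists2 a, a \in A & (a * g * a^-1)%g \notin 'C[g]%g.
Proof.
move=> gS ng; apply/exists_inP; apply: contraT => /exists_inPn H.
have {}H a : a \in A -> (a * g * a^-1)%g \in 'C[g]%g by move/H; rewrite negbK.
have C x : x \in SL2 -> (x * g * x^-1)%g \in 'C[g]%g.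
  rewrite -genA; move: x; apply: (gen_mull_ind A1).
    by rewrite invg1 mulg1 mul1g cent1id.
  move=> a x aA IH; rewrite conjM.
  have aS := ballS (ball1 aA).
  rewrite -(cent1_eq ng _ (H a aA)) ?scalJ //; exact: cent_conj.
have [n1 [n2 [n3 [nz n0]]]] : exists n1 n2 n3 : F,
    ~ [/\ n1 = 0, n2 = 0 & n3 = 0] /\ pair n1 n2 n3 g = 0.
  have [b0|b0] := eqVneq (e21 g) 0.
    exists 0, 1, 0; split; last by rewrite /pair b0; ring.
    by case=> _ /eqP; rewrite oner_eq0.
  exists 0, (e12 g), (- e21 g); split; last by rewrite /pair; ring.
  by case=> _ _ /eqP; rewrite oppr_eq0 (negPf b0).
case: nz; apply: (adjoint_irr two_neq0 gS ng) => h /C /(cent1_lin ng).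
case=> -[a b] /= [h1 h2 h3 h4]; transitivity (b * pair n1 n2 n3 g).
  by rewrite /pair h1 h2 h3 h4; ring.
by rewrite n0 mulr0.
Qed.

(** Otherwise the plane spanned by g and a g a^-1 modulo scalars is stable under [A], since [A]
    sends both vectors to conjugates of g by [A ^+ 2]; [adjoint_irr] excludes this. *)
Lemma exists_crs g a : g \in SL2 -> ~~ scal g -> a \in A ->
  (a * g * a^-1)%g \notin 'C[g]%g ->
  let n := crs g (a * g * a^-1)%g in
  exists2 x, x \in (A ^+ 2)%g & pair n.1.1 n.1.2 n.2 (x * g * x^-1)%g != 0.
Proof.
move=> gS ng aA nC n; apply/exists_inP; apply: contraT => /exists_inPn H.
have {}H x : x \in (A ^+ 2)%g -> pair n.1.1 n.1.2 n.2 (x * g * x^-1)%g = 0.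
  by move/H; rewrite negbK => /eqP.
have nz : ~~ [&& n.1.1 == 0, n.1.2 == 0 & n.2 == 0].
  apply: contra nC => /and3P[/eqP h1 /eqP h2 /eqP h3].
  apply/cent1P/commute_sym/commuteP; split; apply/eqP; rewrite -subr_eq0; apply/eqP.
  - by rewrite -[RHS]oppr0 -h1 /n /crs /=; ring.
  - by rewrite -h2 /n /crs /=; ring.
  - by rewrite -[RHS]oppr0 -h3 /n /crs /=; ring.
suff P x : x \in SL2 -> pair n.1.1 n.1.2 n.2 (x * g * x^-1)%g = 0.
  by have [h1 h2 h3] := adjoint_irr two_neq0 gS ng P; rewrite h1 h2 h3 eqxx in nz.
rewrite -genA; move: x; apply: (gen_mull_ind A1).
  by apply: H; apply: ball_one.
move=> b x bA IH; rewrite conjM.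
have bS := ballS (ball1 bA).
have [[r s] [h1 h2 h3]] := crs_span nz IH.
rewrite (pairJ_lin _ _ _ bS h1 h2 h3) -conjM !H; first by ring.
  by apply: (ball_mul (i := 1) (j := 1)); apply: ball1.
by apply: (ball_le A1 (i := 1)) => //; apply: ball1.
Qed.

(** The hypothesis on [k] makes 1, [g], [h], [k] a basis of the matrices, and the trace form is
    nondegenerate. *)
Lemma crs_sep w y g h :
  let n := crs g h in
  tr2 w = tr2 y -> tr2 (w * g)%g = tr2 (y * g)%g -> tr2 (w * h)%g = tr2 (y * h)%g ->
  forall k, pair n.1.1 n.1.2 n.2 k != 0 -> tr2 (w * k)%g = tr2 (y * k)%g -> w = y.
Proof.
rewrite /crs /pair /=; set N1 := _ - _; set N2 := _ - _; set N3 := _ - _.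
move=> t tg th k nz tk.
pose X := e11 w - e11 y; pose Y := e12 w - e12 y; pose Z := e21 w - e21 y.
have E4 : e22 w = e22 y - X.
  by rewrite /X; move: t; rewrite /tr2 => t;
    transitivity (e11 w + e22 w - e11 w); [ring | rewrite t; ring].
have P r : tr2 (w * r)%g = tr2 (y * r)%g ->
    X * (e11 r - e22 r) + e12 r * Z + e21 r * Y = 0.
  move=> e; apply: (@addIr _ (tr2 (y * r)%g));
    rewrite add0r -{2}e /tr2 !mulE E4 /X /Y /Z; ring.
have Pg := P _ tg; have Ph := P _ th; have Pk := P _ tk.
have comb0 (b c d L M K : F) : L = 0 -> M = 0 -> K = 0 -> b * L + c * M + d * K = 0.
  by move=> -> -> ->; ring.
have X0 : X = 0.
  apply: (mulIf nz); rewrite mul0r.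
  rewrite -(comb0 (e21 h * e12 k - e12 h * e21 k) (e12 g * e21 k - e21 g * e12 k)
     N1 _ _ _ Pg Ph Pk) /N1 /N2 /N3; ring.
have Y0 : Y = 0.
  apply: (mulIf nz); rewrite mul0r.
  rewrite -(comb0 (e12 h * (e11 k - e22 k) - (e11 h - e22 h) * e12 k)
     ((e11 g - e22 g) * e12 k - e12 g * (e11 k - e22 k))
     N2 _ _ _ Pg Ph Pk) /N1 /N2 /N3; ring.
have Z0 : Z = 0.
  apply: (mulIf nz); rewrite mul0r.
  rewrite -(comb0 ((e11 h - e22 h) * e21 k - e21 h * (e11 k - e22 k))
     (e21 g * (e11 k - e22 k) - (e11 g - e22 g) * e21 k)
     N3 _ _ _ Pg Ph Pk) /N1 /N2 /N3; ring.
apply: GL2_eq; rewrite ?E4 ?X0 ?subr0 //; apply/eqP; rewrite -subr_eq0.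
- exact/eqP.
- exact/eqP.
- exact/eqP.
Qed.

Lemma card_class_ge g : g \in SL2 -> ~~ scal g ->
  (q * q.-1 <= 2 * #|[set x * g * x^-1 | x in SL2]%g|)%N.
Proof.
move=> gS ng; have q0 : (0 < q)%N by apply/card_gt0P; exists 0.
have := @card_conj_ball _ SL2 _ g.
rewrite invGid => /(_ erefl); rewrite /conj_ball expg1 expgS expg1 mulGid => h.
rewrite -(leq_pmul2l q0); have := card_SL2_ge F; have := card_torus gS ng.
move: h; set c := #|_|; set s := #|_|; set t := #|_|; nia.
Qed.

Lemma escape g : (4 < q)%N -> g \in SL2 -> regular g ->
  exists2 x, x \in (A ^+ 16)%g & kappa g x != 0.
Proof.
move=> q4 gS rg; have ng := regular_nscal gS rg.
apply/exists_inP; apply: contraT => /exists_inPn H.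
have [a aA nC] := exists_noncommuting gS ng.
have [x3 x3A nz] := exists_crs gS ng aA nC.
pose y2 := (a * g * a^-1)%g; pose y3 := (x3 * g * x3^-1)%g.
(* Two elements of [A ^+ 8] have their quotient in [A ^+ 16], where [kappa] is assumed to vanish;
   its two factors give the two values. *)
have two y z : y \in (A ^+ 8)%g -> z \in (A ^+ 8)%g ->
    let s := tr2 ((y * g * y^-1) * (z * g * z^-1))%g in
    s = 2 \/ s = tr2 g ^+ 2 - 2.
  move=> yA zA; rewrite tr2_mulJ /=; have := H _ (ball_mulV AV yA zA).
  rewrite negbK /kappa mulf_eq0 oppr_eq0 !subr_eq0 => /orP[/eqP|] ; first by left.
  move=> /eqP E; right; apply/eqP; rewrite -subr_eq0; apply/eqP; rewrite -[RHS]E; ring.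
pose B := conj_ball A g 8.
have B1 y : y \in (A ^+ 8)%g -> (y * g * y^-1)%g \in B by exact: mem_conj_ball.
(* By [crs_sep] these three bits determine an element of the partial orbit, whence at most 2^3
   elements. *)
pose f w := (tr2 (w * g)%g == 2, (tr2 (w * y2)%g == 2, tr2 (w * y3)%g == 2)).
have cB : (#|B| <= 8)%N.
  have <- : #|[set: bool * (bool * bool)]| = 8%N by rewrite cardsT !card_prod !card_bool.
  apply: (@card_leq_inj _ _ _ _ f) => // _ _ /imsetP[y yA ->] /imsetP[z zA ->].
  have sep k : k \in (A ^+ 8)%g ->
     (tr2 (y * g * y^-1 * (k * g * k^-1))%g == 2) =
       (tr2 (z * g * z^-1 * (k * g * k^-1))%g == 2) ->
     tr2 (y * g * y^-1 * (k * g * k^-1))%g = tr2 (z * g * z^-1 * (k * g * k^-1))%g.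
    move=> kA; case: (two y k yA kA) (two z k zA kA) => -> [] -> //.
      by rewrite eqxx => /esym/eqP.
    by rewrite eqxx => /eqP.
  rewrite /f => -[f1 f2 f3].
  apply: (crs_sep (g := g) (h := y2) _ _ _ nz).
  - by rewrite !tr2J.
  - by have := sep 1%g (ball_one A1 8); rewrite invg1 mulg1 mul1g; apply.
  - by apply: sep f2; apply: (ball_le A1 (i := 1)) => //; apply: ball1.
  - by apply: sep f3; apply: (ball_le A1 (i := 2)).
(* With at most 8 elements at radius 8 the orbit is complete, which contradicts [card_class_ge] as
   soon as q is at least 5. *)
have [|full] := conj_ball_growth A1 g 8; first by rewrite ltnNge cB.
have : (#|[set x * g * x^-1 | x in SL2]%g| <= 8)%N.
  apply: leq_trans cB; apply: subset_leq_card; apply/subsetP => _ /imsetP[x xS ->].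
  by apply: full; rewrite genA.
have := card_class_ge gS ng; move: #|_| q4; move: q => [|n] //= m; nia.
Qed.

End Escape.

(** * Dimension estimates *)

Section Dimension.
Variable F : finFieldType.
Hypothesis two_neq0 : (2 : F) != 0.
Implicit Types u v g h x d w c : GL2 F.
Local Notation SL2 := (SL2 F).
Local Notation q := #|F|.
Hypothesis q_gt4 : (4 < q)%N.

Lemma card_scal : (#|[set z in SL2 | scal z]| <= 2)%N.
Proof.
apply: card_le2 => x y z.
have key w : w \in [set z in SL2 | scal z] ->
    [/\ e11 w ^+ 2 = 1, e12 w = 0, e21 w = 0 & e22 w = e11 w].
  case/setIdP => wS /and3P[/eqP h2 /eqP h3 /eqP h1]; split=> //.
  by have /eqP := detE wS; rewrite h2 h3 -h1 mul0r eq_sym subr_eq0 => /eqP.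
move=> /key[x1 x2 x3 x4] /key[y1 y2 y3 y4] /key[z1 z2 z3 z4].
have opp w : e11 w ^+ 2 = 1 -> e12 w = 0 -> e21 w = 0 -> e22 w = e11 w ->
    w != x -> e11 w = - e11 x.
  move=> w1 w2 w3 w4 wx; have /eqP : e11 w ^+ 2 = e11 x ^+ 2 by rewrite w1.
  rewrite eqf_sqr => /orP[|] /eqP // e; case/eqP: wx.
  by apply: GL2_eq; rewrite ?w2 ?w3 ?w4 ?x2 ?x3 ?x4.
move=> /(opp _ y1 y2 y3 y4) yx /(opp _ z1 z2 z3 z4) zx.
by apply: GL2_eq; rewrite ?y2 ?y3 ?y4 ?z2 ?z3 ?z4 ?yx ?zx.
Qed.

Lemma cent1_sym g h : h \in 'C[g]%g -> g \in 'C[h]%g.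
Proof. by move/cent1P => c; apply/cent1P. Qed.

(** Here [m] normalizes the torus, so it conjugates [g] to [g] or to its inverse, and these give the
    two values. *)
Lemma inv_form_normal g m c : g \in SL2 -> m \in SL2 -> c \in SL2 -> regular g ->
  c \in 'C[g]%g -> ~~ scal c -> (m^-1 * c * m)%g \in 'C[g]%g ->
  inv_form g m = 2 \/ inv_form g m = tr2 g ^+ 2 - 2.
Proof.
move=> gS mS cS rg cC nc eC; have ng := regular_nscal gS rg.
have mVS : (m^-1)%g \in SL2 by rewrite groupV.
have eC' : (m^-1 * c * m^-1^-1)%g \in 'C[g]%g by rewrite invgK.
have := cent_conj (m^-1)%g (cent1_sym cC).
rewrite (cent1_eq ng _ eC') ?scalJ // => fC.
have -> : inv_form g m = tr2 (g * (m * g * m^-1))%g by rewrite /inv_form !mulgA.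
have := cent_tr_eq two_neq0 gS gS (SLJ gS mVS) rg (cent1id _) fC (esym (tr2J _ _)).
rewrite invgK => -[] e.
  have -> : (m * g * m^-1 = g)%g by rewrite -{1}e !mulgA mulgV mul1g mulgK.
  by right; rewrite /tr2 !mulE; ring: (detE gS).
have -> : (m * g * m^-1 = g^-1)%g.
  by rewrite -{1}(invgK g) -e !invMg !invgK !mulgA mulgV mul1g mulgK.
by left; rewrite mulgV /tr2 !oneE.
Qed.

Variable A : {set GL2 F}.
Hypotheses (A1 : 1%g \in A) (AV : (A^-1 = A)%g) (genA : <<A>>%g = SL2).
Local Notation M := #|A ^+ 64|%g.

Let ballS := ballS genA.

(** The value fixes [b ^+ 2], hence the trace up to sign, and each trace leaves an element and its
    inverse: 2 * 2 = 4. *)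
Lemma card_inv_form g x (v : F) : g \in SL2 -> regular g -> x \in SL2 ->
  kappa g x != 0 ->
  (#|[set d in (A ^+ 2 :&: 'C[g])%g | inv_form g (x * d * x^-1)%g == v]| <= 4)%N.
Proof.
move=> gS rg xS k0; set S := [set d in _ | _].
have ng := regular_nscal gS rg.
have S1 d : d \in S -> [/\ d \in SL2, d \in 'C[g]%g & exists b,
    tr2 d ^+ 2 - 4 = b ^+ 2 * (tr2 g ^+ 2 - 4) /\ v =
      tr2 g ^+ 2 - 2 + kappa g x * b ^+ 2].
  rewrite in_set in_setI => /andP[/andP[/ballS dS dC] /eqP e].
  split=> //; have [a [b [l E]]] := cent1_linSL gS dS ng dC.
  by exists b; rewrite (lin_disc l E) -e (inv_form_torus gS dS xS l E).
have S2 d d' : d \in S -> d' \in S -> tr2 d = tr2 d' \/ tr2 d = - tr2 d'.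
  move=> /S1[_ _ [b [E1 E2]]] /S1[_ _ [b' [E1' E2']]].
  have : tr2 d ^+ 2 = tr2 d' ^+ 2.
    apply: (@addIr _ (-4)); rewrite E1 E1'; congr (_ * _).
    by apply: (mulfI k0); apply: (@addrI _ (tr2 g ^+ 2 - 2)); rewrite -E2 -E2'.
  by move/eqP; rewrite eqf_sqr => /orP[] /eqP; [left|right].
apply: (@leq_trans (2 * #|[set tr2 d | d in S]|)).
  apply: (@leq_card_fibers _ _ _ _ (@tr2 F)) => [d dS|d /S1[dS dC _]].
    by apply/imsetP; exists d.
  apply: leq_trans (_ : #|[set d; d^-1]%g| <= 2)%N; last by rewrite cards2; case: eqP.
  apply: subset_leq_card; apply/subsetP => d';
    rewrite in_set => /andP[/S1[dS' dC' _] /eqP e].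
  by rewrite !inE; case: (cent_tr_eq two_neq0 gS dS dS' rg dC dC' (esym e)) => ->;
    rewrite eqxx ?orbT.
rewrite (leq_mul2l 2 _ 2) /=; apply: card_le2 => x0 y0 z0 /imsetP[d dS ->].
move=> /imsetP[d1 dS1 ->] /imsetP[d2 dS2 ->].
by case: (S2 _ _ dS1 dS) => ->; rewrite ?eqxx // => _; case: (S2 _ _ dS2 dS) => ->;
  rewrite ?eqxx.
Qed.

(* The map (d1, d2, d3) |-> d1 x d2 x^-1 d3 has bounded fibers: [inv_form]
   recovers d2 up to 4 choices, and then d1, d3 are known up to sign. *)
Lemma torus_upper g : g \in SL2 -> regular g ->
  (#|(A ^+ 2 :&: 'C[g])%g| ^ 3 <= 4096 * M)%N.
Proof.
move=> gS rg; have ng := regular_nscal gS rg.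
have [x xA k0] := escape two_neq0 A1 AV genA q_gt4 gS rg.
have xS := ballS xA.
have c4 (v : F) := @card_inv_form g x v gS rg xS k0.
set D := (A ^+ 2 :&: 'C[g])%g in c4 *.
have D2 d : d \in D -> d \in (A ^+ 2)%g by case/setIP.
have DP d : d \in D -> d \in SL2 /\ d \in 'C[g]%g by case/setIP => /ballS.
clearbody D.
pose I d := inv_form g (x * d * x^-1)%g.
(* Discarding the two values of [inv_form_normal], at a cost of 4 + 4 elements, forces the ambiguity
   in [d1] and [d3] to be scalar. *)
pose E := [set d in D | (I d != 2) && (I d != tr2 g ^+ 2 - 2)].
have DE : (#|D| <= #|E| + 8)%N.
  have : D \subset E :|: ([set d in D | I d == 2] :|:
    [set d in D | I d == tr2 g ^+ 2 - 2]).
    apply/subsetP => d dD; rewrite !in_setU !in_set dD /=.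
    by case: (I d == 2) => //=; case: (I d == _).
  move/subset_leq_card => h; apply: leq_trans h _.
  apply: leq_trans (leq_card_setU _ _) _; rewrite leq_add2l.
  by apply: leq_trans (leq_card_setU _ _) _; apply: (leq_add (c4 _) (c4 _)).
pose phi (t : GL2 F * (GL2 F * GL2 F)) := (t.2.1 * (x * t.1 * x^-1) * t.2.2)%g.
have M1 : (0 < M)%N by apply/card_gt0P; exists 1%g; apply: ball_one.
have : (#|setX E (setX D D)| <= 8 * M)%N.
  apply: (@leq_card_fibers _ _ _ _ phi).
    move=> [d2 [d1 d3]]; rewrite !in_setX /= in_set.
    case/and3P => /andP[/D2 h2 _] /D2 h1 /D2 h3.
    apply: (ball_le A1 (i := 2 + (16 + 2 + 16) + 2)) => //.
    by rewrite /phi /= !ball_mul // ball_inv.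
  move=> [f2 [f1 f3]]; rewrite !in_setX => /and3P[f2E f1D f3D].
  set S := [set t in _ | _].
  have SP t : t \in S -> [/\ t.1 \in E, t.2.1 \in D, t.2.2 \in D & phi t = phi (f2,
    (f1, f3))].
    by case: t => [t1 [t2 t3]]; rewrite in_set !in_setX => /andP[/and3P[? ? ?] /eqP].
  apply: (@leq_trans (2 * #|[set d in D | I d == I f2]|)); last first.
    by rewrite (leq_mul2l 2 _ 4) /= c4.
  apply: (@leq_card_fibers _ _ _ _ fst).
    move=> [d2 [d1 d3]] /SP[/=]; rewrite in_set => /andP[d2D _] d1D d3D e.
    rewrite in_set d2D /= /I; apply/eqP.
    rewrite -(inv_formM _ (proj2 (DP _ d1D)) (proj2 (DP _ d3D))).
    rewrite -[RHS](inv_formM _ (proj2 (DP _ f1D)) (proj2 (DP _ f3D))).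
    by congr inv_form.
  move=> [d2 [d1 d3]] /SP[/= d2E d1D d3D ed].
  apply: leq_trans card_scal.
  have key t : t \in [set t in S | t.1 == d2] ->
    [/\ t.1 = d2, t.2.1 \in D, t.2.2 \in D &
      (t.2.1 * (x * d2 * x^-1) * t.2.2 = d1 * (x * d2 * x^-1) * d3)%g].
    rewrite in_set => /andP[/SP[_ h1 h2 e]] /eqP e1; split=> //.
    by have := etrans e (esym ed); rewrite /phi /= e1.
  apply: (@card_leq_inj _ _ _ _ (fun t => t.2.1^-1 * d1)%g).
    move=> t /key[_]; move: t.2.1 t.2.2 => b1 b3 b1D b3D e.
    have [b1S b1C] := DP _ b1D; have [b3S b3C] := DP _ b3D.
    have [d1S d1C] := DP _ d1D; have [d3S d3C] := DP _ d3D.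
    have cS : (b1^-1 * d1)%g \in SL2 by rewrite groupM ?groupV.
    rewrite in_set cS /=; apply: contraT => nc.
    have [d2D /andP[n1 n2]] : d2 \in D /\ (I d2 != 2) && (I d2 != tr2 g ^+ 2 - 2).
      by move: d2E; rewrite in_set => /andP[].
    case: (@inv_form_normal g (x * d2 * x^-1)%g (b1^-1 * d1)%g) => //.
    - by apply: SLJ => //; have [] := DP _ d2D.
    - by rewrite groupM ?groupV.
    - move: (x * d2 * x^-1)%g e => m e.
      have -> : (m^-1 * (b1^-1 * d1) * m = b3 * d3^-1)%g; last by rewrite groupM ?groupV.
      apply: (@mulIg _ d3); rewrite mulgKV; apply: (@mulgI _ m); apply: (@mulgI _ b1).
      by rewrite !mulgA e mulgK mulgV mul1g.
    - by move=> h; rewrite /I h eqxx in n1.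
    - by move=> h; rewrite /I h eqxx in n2.
  move=> [a2 [a1 a3]] [b2 [b1 b3]] /key[/= -> _ _ ea] /key[/= -> _ _ eb].
  move=> /mulIg /invg_inj h; rewrite h in ea *; congr (_, (_, _)).
  by move: ea; rewrite -eb; apply: mulgI.
rewrite !cardsX; move: DE M1; move: #|D| #|E| M => a b m.
(* From 16 on, discarding 8 elements leaves at least half of them; below 16 the bound is trivial,
   since 4096 = 16^3. *)
have [a16 ba _ h|a16 _ m1 _] := leqP 16 a.
  have : (a <= 2 * b)%N by lia.
  move=> ab; have : (a * (a * a) <= 2 * b * (a * a))%N by rewrite leq_mul2r ab orbT.
  rewrite !expnS expn0; lia.
apply: (@leq_trans (16 ^ 3 * 1)); last by rewrite leq_mul.
by rewrite muln1 leq_exp2r // ltnW.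
Qed.

End Dimension.

(** * Growth by pivoting *)

Section Growth.
Variable F : finFieldType.
Hypothesis two_neq0 : (2 : F) != 0.
Implicit Types u v g h x d w c a b s : GL2 F.
Local Notation SL2 := (SL2 F).
Local Notation q := #|F|.
Hypothesis q_gt4 : (4 < q)%N.
Variable A : {set GL2 F}.
Hypotheses (A1 : 1%g \in A) (AV : (A^-1 = A)%g) (genA : <<A>>%g = SL2).
Local Notation M := #|A ^+ 64|%g.

Let ballS := ballS genA.
Let torus_upper := torus_upper two_neq0 q_gt4 A1 AV genA.

Lemma ball_card_gt0 i : (0 < #|(A ^+ i)%g|)%N.
Proof. by apply/card_gt0P; exists 1%g; apply: ball_one. Qed.

Lemma ball_card_le i j : (i <= j)%N -> (#|(A ^+ i)%g| <= #|(A ^+ j)%g|)%N.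
Proof. by move=> ij; apply/subset_leq_card/ball_sub. Qed.

Lemma card_A_le : (#|A| <= M)%N.
Proof. by have := @ball_card_le 1 64 isT; rewrite expg1. Qed.

Lemma ballJ i a h : a \in A -> h \in (A ^+ i)%g ->
  (a * h * a^-1)%g \in (A ^+ (1 + i + 1))%g.
Proof.
move=> aA hA; apply: ball_mul; first by apply: ball_mul => //; apply: ball1.
by apply: (ball_inv AV); apply: ball1.
Qed.

(* Elements of distinct traces have disjoint conjugation orbits, and the orbit
   of a regular element is large since its centralizer is a torus. *)
Lemma card_regular_traces (Y : {set GL2 F}) : Y \subset (A ^+ 38)%g ->
  (#|[set t in [set tr2 y | y in Y] | (t ^+ 2 != 4)%R]| ^ 3 * #|A| ^ 3 <= 4096 * M ^ 4)%N.
Proof.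
move=> sY; set T := [set t in _ | _].
(* The least such [n] is an integer substitute for a cube root; by minimality it bounds from below
   the size of every orbit involved. *)
have exn : exists n, (#|A| ^ 3 <= 4096 * M * n ^ 3)%N.
  exists #|A|; rewrite -[leqLHS]mul1n leq_mul2r; apply/orP; right.
  by rewrite muln_gt0 ball_card_gt0.
case: (ex_minnP exn) => n hn minn.
have : (n * #|T| <= M)%N.
  apply: (@geq_card_fibers _ _ _ _ (@tr2 F)) => t;
    rewrite in_set => /andP[/imsetP[y yY ty] reg].
  have yA := subsetP sY _ yY; have yS := ballS yA.
  apply: minn; have oy := card_conj_ball AV y.
  apply: (@leq_trans ((#|(A ^+ 2 :&: 'C[y])%g| * #|conj_ball A y 1|) ^ 3)).
    by rewrite leq_exp2r.
  rewrite expnMn; apply: leq_mul.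
    by apply: torus_upper => //; rewrite /regular -ty.
  rewrite leq_exp2r //; apply: subset_leq_card; apply/subsetP => y' /imsetP[a].
  rewrite expg1 => aA ->; rewrite in_set tr2J ty eqxx andbT.
  exact: (ball_le A1 (i := 1 + 38 + 1) (j := 64) isT (ballJ aA yA)).
move=> nT; rewrite -expnMn.
apply: (@leq_trans (4096 * M * (n * #|T|) ^ 3)).
  by rewrite (expnMn n) expnMn mulnC mulnA leq_mul2r hn orbT.
by rewrite -mulnA leq_mul2l (expnS M) leq_mul2l leq_exp2r // nT !orbT.
Qed.

(** Only the traces 2 and -2 are added to the regular ones, which at most doubles their number once
    there are two of them; otherwise there are at most 3 traces. *)
Lemma card_traces (Y : {set GL2 F}) : Y \subset (A ^+ 38)%g ->
  (#|[set tr2 y | y in Y]| ^ 3 * #|A| ^ 3 <= 2 ^ 15 * M ^ 4)%N.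
Proof.
move=> /card_regular_traces /=; set T := [set tr2 y | y in Y]; set T' := [set t in _ | _].
have TT' : (#|T| <= #|T'| + 2)%N.
  apply: (@leq_trans (#|T'| + #|[set (2 : F); -2]|)); last first.
    by rewrite leq_add2l cards2; case: (_ == _).
  apply: leq_trans (leq_card_setU _ _); apply: subset_leq_card; apply/subsetP => t tT.
  rewrite in_setU in_set tT /= !inE.
  have -> : (4 : F) = 2 ^+ 2 by ring.
  by rewrite eqf_sqr negb_or; case: eqP => //=; case: eqP.
have := card_A_le; have := ball_card_gt0 64.
move: TT'; move: #|T| #|T'| #|A| M => t t' a m tt m0 am.
case: (leqP 2 t') => [t2|t2] h.
  have {}tt : (t <= 2 * t')%N by lia.
  apply: (@leq_trans ((2 * t') ^ 3 * a ^ 3)).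
    by rewrite leq_mul2r leq_exp2r // tt orbT.
  by rewrite expnMn -mulnA (expnD 2 3 12) -mulnA leq_mul2l h orbT.
apply: (@leq_trans (3 ^ 3 * m ^ 4)); last by rewrite leq_mul2r; apply/orP; right.
apply: leq_mul; first by rewrite leq_exp2r //; lia.
by rewrite (expnS m) (leq_trans (n := m ^ 3)) ?leq_exp2r // leq_pmull.
Qed.

(** By [trace_fiber], the traces against [g] and [b] determine an element of the orbit up to two
    choices, and [card_traces] bounds both sets of traces: 2^33 = 2^3 * 2^15 * 2^15. *)
Lemma class_upper g : g \in (A ^+ 2)%g -> regular g ->
  (#|conj_ball A g 1| ^ 3 * #|A| ^ 6 <= 2 ^ 33 * M ^ 8)%N.
Proof.
move=> gA rg; have gS := ballS gA.
have [x xA k0] := escape two_neq0 A1 AV genA q_gt4 gS rg.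
have xS := ballS xA.
set b := (x * g * x^-1)%g.
have bA : b \in (A ^+ 34)%g.
  by apply: (ball_mul (i := 16 + 2) (j := 16)); rewrite ?ball_inv // ball_mul.
have n0 : let n := crs g b in n.1.1 ^+ 2 + n.1.2 * n.2 != 0.
  by rewrite /= (crs_kappa gS xS) oppr_eq0.
set S := conj_ball A g 1.
have SA s : s \in S -> s \in (A ^+ 4)%g.
  by case/imsetP=> a; rewrite expg1 => aA ->; apply: (ballJ (i := 2)).
have St s : s \in S -> tr2 s = tr2 g by case/imsetP=> a aA ->; rewrite tr2J.
have sub c : c \in (A ^+ 34)%g -> [set c * s | s in S]%g \subset (A ^+ 38)%g.
  move=> cA; apply/subsetP => _ /imsetP[s sS ->].
  by apply: (ball_mul (i := 34) (j := 4)) => //; apply: SA.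
have Tg := card_traces (sub g (ball_le A1 (i := 2) (j := 34) isT gA)).
have Tb := card_traces (sub b bA).
have : (#|S| <= 2 * (#|[set tr2 y | y in [set g * s | s in S]%g]| *
                    #|[set tr2 y | y in [set b * s | s in S]%g]|))%N.
  rewrite -cardsX; apply: (@leq_card_fibers _ _ _ _ (fun s =>
    (tr2 (g * s)%g, tr2 (b * s)%g))).
    by move=> s sS; rewrite in_setX; apply/andP; split; apply: imset_f; apply: imset_f.
  move=> s sS; apply: card_le2 => s0 s1 s2.
  rewrite !in_set => /andP[S0 /eqP[g0 b0]] /andP[S1 /eqP[g1 b1]] /andP[S2 /eqP[g2 b2]].
  have SS s' : s' \in S -> s' \in SL2 by move/SA/ballS.
  apply: (trace_fiber n0); [exact: SS | exact: SS | exact: SS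
    | by rewrite !St | by rewrite !St | by rewrite g1 g0 | by rewrite g2 g0
    | by rewrite b1 b0 | by rewrite b2 b0].
move: Tg Tb; move: #|[set tr2 y | y in [set g * s | s in S]%g]|.
move: #|[set tr2 y | y in [set b * s | s in S]%g]| #|S| #|A| M => tb s a m tg Tg Tb h.
apply: (@leq_trans ((2 * (tg * tb)) ^ 3 * a ^ 6)).
  by rewrite leq_mul2r leq_exp2r // h orbT.
rewrite !expnMn -(mulnA (2 ^ 3)%N) (expnD 2 3 30) -(mulnA (2 ^ 3)%N) leq_mul2l;
  apply/orP; right.
rewrite (expnD a 3 3) mulnACA (expnD 2 15 15) (expnD m 4 4) [leqRHS]mulnACA.
exact: leq_mul.
Qed.

(** Orbit-stabilizer turns the upper bound on the orbit into a lower bound on the stabilizer. *)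
Lemma torus_lower g : g \in (A ^+ 2)%g -> regular g ->
  (#|A| ^ 9 <= 2 ^ 33 * M ^ 8 * #|(A ^+ 2 :&: 'C[g])%g| ^ 3)%N.
Proof.
move=> gA rg; have := class_upper gA rg; have := card_conj_ball AV g.
move: #|_ :&: _| #|conj_ball _ _ _| #|A| M => d s a m h1 h2.
rewrite (expnD a 3 6); apply: (@leq_trans ((d * s) ^ 3 * a ^ 6)).
  by rewrite leq_mul2r leq_exp2r // h1 orbT.
by rewrite expnMn -mulnA mulnC leq_mul2r h2 orbT.
Qed.

Lemma exists_regular_ball : exists2 g, g \in (A ^+ 2)%g & regular g.
Proof.
have [u uA nu] : exists2 u, u \in A & ~~ scal u.
  apply/exists_inP; apply: contraT => /exists_inPn H.
  have : SL2 \subset [set z in SL2 | scal z].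
    apply/subsetP => x xS; rewrite in_set xS /=.
    move: xS; rewrite -genA; move: x; apply: (gen_mull_ind A1).
      by rewrite /scal !oneE !eqxx.
    move=> v x /H; rewrite negbK => /and3P[/eqP h1 /eqP h2 /eqP h3].
    move=> /and3P[/eqP k1 /eqP k2 /eqP k3].
    by rewrite /scal !mulE h1 h2 h3 k1 k2 k3 !mulr0 !mul0r !addr0 add0r !eqxx.
  move/subset_leq_card => h; have := leq_trans h (card_scal F).
  rewrite leqNgt (leq_trans _ (card_SL2_ge F)) //.
  by move: q_gt4; case: q => [//|n] n4; rewrite /= !expnS expn0; clear -n4; nia.
have uS := ballS (ball1 uA).
have [v vA nC] := exists_noncommuting two_neq0 A1 genA uS nu.
have vS := ballS (ball1 vA).
have nC' : v \notin 'C[u]%g.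
  apply: contra nC => /cent1P e; rewrite e mulgK; exact: cent1id.
have [z zs rz] := exists_regular two_neq0 uS vS nC'.
exists z => //; move: zs; rewrite !in_cons in_nil orbF => /or4P[] /eqP ->.
- by apply: (ball_le A1 (i := 1)) => //; apply: ball1.
- by apply: (ball_le A1 (i := 1)) => //; apply: ball1.
- by apply: (ball_mul (i := 1) (j := 1)); apply: ball1.
- by apply: (ball_mul (i := 1) (j := 1)); rewrite ?(ball_inv AV) //; apply: ball1.
Qed.

(* [x] is a pivot for the torus [C(g)] when [nonpivot g x] fails: then
   (b, d) |-> b d is injective up to sign on [A * (x C(g) x^-1)]. *)
Definition nonpivot g x :=
  [exists h in (A ^+ 2)%g, ~~ scal h && (h \in 'C[x * g * x^-1]%g)].

Lemma pivot_growth g x a : g \in SL2 -> regular g -> x \in SL2 -> a \in A ->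
  nonpivot g x -> ~~ nonpivot g (a * x)%g -> (#|A| ^ 12 <= 2 ^ 36 * M ^ 11)%N.
Proof.
move=> gS rg xS aA /exists_inP[h hA /andP[nh hC]] /exists_inPn piv.
have hS := ballS hA; have jS := SLJ gS xS.
have rj : regular (x * g * x^-1)%g by rewrite /regular tr2J.
have rh := regular_cent jS hS rj hC nh.
have := torus_lower hA rh; rewrite (cent1_eq (regular_nscal jS rj) nh hC).
set D := (A ^+ 2 :&: _)%g => lowD.
have : (#|setX A D| <= 2 * M)%N.
  apply: (@leq_card_fibers _ _ _ _ (fun t => t.1 * (a * t.2 * a^-1))%g).
    move=> [b d]; rewrite in_setX /= => /andP[bA /setIP[dA _]].
    apply: (ball_le A1 (i := 1 + (1 + 2 + 1))) => //; apply: ball_mul; first exact: ball1.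
    exact: ballJ.
  move=> [b0 d0]; rewrite in_setX /= => /andP[b0A /setIP[d0A d0C]].
  apply: leq_trans (card_scal F).
  have key t : t \in [set t in setX A D | (t.1 * (a * t.2 * a^-1) == b0 * (a * d0 *
    a^-1))%g] ->
      [/\ t.1 \in A, t.2 \in 'C[x * g * x^-1]%g &
         (t.1 * (a * t.2 * a^-1) = b0 * (a * d0 * a^-1))%g].
    case: t => b d; rewrite in_set in_setX /= => /andP[/andP[bA /setIP[_ dC]] /eqP e].
    by split.
  apply: (@card_leq_inj _ _ _ _ (fun t => t.1^-1 * b0)%g).
    (* The quotient of two first components in a fiber lies in [A ^+ 2] and in the torus attached to
       [a * x], so the pivot property makes it scalar. *)
    move=> t /key; move: t.1 t.2 => b d [bA dC e].
    have cA : (b^-1 * b0)%g \in (A ^+ 2)%g.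
      by apply: (ball_mulV AV (i := 1)); apply: ball1.
    rewrite in_set (ballS cA) /=; have := piv _ cA; rewrite negb_and negbK => /orP[//|].
    have -> : (b^-1 * b0 = a * (d * d0^-1) * a^-1)%g.
      apply: (@mulIg _ (a * d0 * a^-1)%g); rewrite -mulgA -e !mulgA mulVg mul1g.
      by rewrite mulgKV mulgKV.
    by rewrite conjM cent_conj // groupM ?groupV.
  move=> [b d] [b' d'] /key[/= _ _ e] /key[/= _ _ e'] /mulIg /invg_inj bb.
  rewrite bb in e *; congr (_, _).
  apply: (@mulgI _ a); apply: (@mulIg _ (a^-1)%g); apply: (@mulgI _ b').
  exact: etrans e (esym e').
rewrite cardsX; move: lowD; move: #|A| #|D| M => k d m h1 h2.
rewrite (expnD k 9 3); apply: (@leq_trans (2 ^ 33 * m ^ 8 * d ^ 3 * k ^ 3)).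
  by rewrite leq_mul2r h1 orbT.
rewrite -mulnA -expnMn (mulnC d) (expnD 2 33 3) (expnD m 8 3) [leqRHS]mulnACA.
by rewrite leq_mul // -expnMn leq_exp2r.
Qed.

(** The element x^-1 h x lies in the torus of g with the trace of h, so it takes at most two values;
    each value confines x to a coset of the torus of h. *)
Lemma card_conj_torus g h : g \in SL2 -> regular g -> h \in SL2 -> ~~ scal h ->
  (#|[set x in SL2 | h \in 'C[x * g * x^-1]%g]| <= 4 * q)%N.
Proof.
move=> gS rg hS nh; set X := [set x in _ | _].
have XP x : x \in X -> [/\ x \in SL2,
  (x^-1 * h * x)%g \in SL2 & (x^-1 * h * x)%g \in 'C[g]%g].
  rewrite in_set => /andP[xS hC]; split=> //; first by rewrite !groupM ?groupV.
  have := cent_conj (x^-1)%g hC; rewrite invgK.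
  by rewrite !mulgA mulVg mul1g mulgKV.
have [->|[x0 x0X]] := set_0Vmem X; first by rewrite cards0.
have [x0S k0S k0C] := XP _ x0X.
apply: (@leq_trans (2 * q * #|[set x0^-1 * h * x0; (x0^-1 * h * x0)^-1]%g|)).
  apply: (@leq_card_fibers _ _ _ _ (fun x => x^-1 * h * x)%g).
    move=> x /XP[xS kS kC]; rewrite !inE.
    have := cent_tr_eq two_neq0 gS k0S kS rg k0C kC.
    have trE y : tr2 (y^-1 * h * y)%g = tr2 h by rewrite -{2}(invgK y) tr2J.
    by rewrite !trE => /(_ erefl) [] ->; rewrite eqxx ?orbT.
  move=> x xX; have [xS kS kC] := XP _ xX.
  apply: leq_trans (card_torus hS nh).
  apply: (@card_leq_inj _ _ _ _ (fun y => y * x^-1)%g).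
    move=> y; rewrite in_set => /andP[/XP[yS _ _] /eqP e].
    rewrite in_setI groupM ?groupV //=; apply/cent1P.
    rewrite /commute; apply: (@mulgI _ (y^-1)%g); apply: (@mulIg _ x).
    by rewrite !mulgA mulVg mul1g !mulgKV e.
  by move=> y z _ _ /mulIg.
apply: (@leq_trans (2 * q * 2)); last by rewrite mulnAC.
by rewrite leq_mul2l cards2; case: (_ != _); rewrite orbT.
Qed.

(** Double counting of the pairs (x, h) with h nonscalar in [A ^+ 2] and in x C(g) x^-1: each x has
    at least [n] partners by [torus_lower], each h at most 4q. *)
Lemma nopivot_growth g : g \in SL2 -> regular g ->
  (forall x, x \in SL2 -> nonpivot g x) -> (q ^ 6 * #|A| ^ 9 <= 2 ^ 47 * M ^ 11)%N.
Proof.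
move=> gS rg np.
(* Again an integer cube root. The factor 2^38 = 2^33 * 2^5 absorbs 3^3, the cost of removing at
   most two scalars. *)
have exn : exists n, (#|A| ^ 9 <= 2 ^ 38 * M ^ 8 * n ^ 3)%N.
  exists (#|A| ^ 3)%N; rewrite -expnM -[leqLHS]mul1n leq_mul2r; apply/orP; right.
  by rewrite muln_gt0 !expn_gt0 ball_card_gt0.
case: (ex_minnP exn) => n hn minn.
pose P := [set t : GL2 F * GL2 F | [&& t.1 \in SL2, t.2 \in (A ^+ 2)%g, ~~ scal t.2
   & t.2 \in 'C[t.1 * g * t.1^-1]%g]].
have lowP : (n * #|SL2| <= #|P|)%N.
  apply: (@geq_card_fibers _ _ _ _ fst) => x xS; apply: minn.
  have /exists_inP[h hA /andP[nh hC]] := np _ xS.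
  have hS := ballS hA; have jS := SLJ gS xS.
  have rj : regular (x * g * x^-1)%g by rewrite /regular tr2J.
  have rh := regular_cent jS hS rj hC nh.
  have := torus_lower hA rh; rewrite (cent1_eq (regular_nscal jS rj) nh hC).
  set D := (A ^+ 2 :&: _)%g => lowD.
  pose D' := [set d in D | ~~ scal d].
  have D'D : (#|D| <= 3 * #|D'|)%N.
    have D'0 : (0 < #|D'|)%N.
      by apply/card_gt0P; exists h; rewrite in_set nh andbT in_setI hA.
    apply: (@leq_trans (#|D'| + 2)); last by move: D'0; move: #|D'| => k; clear; lia.
    apply: (@leq_trans (#|D'| + #|[set z in SL2 | scal z]|));
      last by rewrite leq_add2l card_scal.
    apply: leq_trans (leq_card_setU _ _); apply: subset_leq_card; apply/subsetP => d dD.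
    rewrite in_setU (in_set (fun z => _ && ~~ _)) dD /= in_set.
    by case/setIP: dD => /ballS -> _ /=; case: scal.
  have D'P : (#|D'| <= #|[set t in P | t.1 == x]|)%N.
    apply: (@card_leq_inj _ _ _ _ (fun d => (x, d))); last by move=> ? ? _ _ [].
    move=> d; rewrite in_set => /andP[/setIP[dA dC] nd].
    by rewrite in_set eqxx andbT in_set /= xS dA nd.
  apply: leq_trans lowD _; move: D'D D'P;
    move: #|D| #|D'| #|[set _ in _ | _]| => d d' p h1 h2.
  have dp : (d <= 3 * p)%N by apply: leq_trans h1 _; rewrite leq_mul2l h2 orbT.
  apply: (@leq_trans (2 ^ 33 * M ^ 8 * (3 * p) ^ 3));
    first by rewrite leq_mul2l leq_exp2r // dp orbT.
  have : (3 ^ 3 <= 2 ^ 5)%N by [].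
  rewrite (expnD 2 33 5) expnMn.
  move: (2 ^ 33)%N (M ^ 8)%N (p ^ 3)%N (3 ^ 3)%N (2 ^ 5)%N => r1 r2 r3 r4 r5 h45.
  rewrite (_ : r1 * r2 * (r4 * r3) = r1 * r2 * r3 * r4)%N; last by ring.
  rewrite (_ : r1 * r5 * r2 * r3 = r1 * r2 * r3 * r5)%N; last by ring.
  by rewrite leq_mul2l h45 orbT.
have upP : (#|P| <= 4 * q * #|(A ^+ 2)%g|)%N.
  apply: (@leq_card_fibers _ _ _ _ snd) => [[x h]|[x h]];
    rewrite in_set /= => /and4P[xS hA nh hC] //.
  apply: leq_trans (card_conj_torus gS rg (ballS hA) nh).
  apply: (@card_leq_inj _ _ _ _ fst) => [[y k]|[y k] [y' k']] /=.
    by rewrite in_set /= in_set => /andP[/and4P[yS _ _ kC] /eqP <-]; rewrite in_set yS.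
  by rewrite in_set => /andP[_ /eqP /= ->]; rewrite in_set => /andP[_ /eqP /= ->] ->.
have nq : (n * q ^ 2 <= 8 * M)%N.
  have M2 : (#|(A ^+ 2)%g| <= M)%N by apply: ball_card_le.
  have q0 : (0 < q)%N by apply: leq_trans q_gt4.
  rewrite -(leq_pmul2l q0).
  have : (n * (q ^ 2 * q.-1) <= 4 * q * M)%N.
    apply: leq_trans (leq_mul (leqnn n) (card_SL2_ge F)) _.
    by apply: leq_trans lowP (leq_trans upP _); rewrite leq_mul2l M2 orbT.
  have qq : (q <= 2 * q.-1)%N by move: q_gt4; case: q => [//|k]; clear; rewrite /=; lia.
  move=> h; apply: (@leq_trans (2 * (n * (q ^ 2 * q.-1)))).
    move: qq; move: q.-1 (q ^ 2)%N => r' Q; move: q => r qq.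
    by have := leq_mul (leqnn (n * Q)) qq; clear; lia.
  by apply: leq_trans (leq_mul (leqnn 2) h) _; apply: eq_leq; ring.
have -> : (q ^ 6 = (q ^ 2) ^ 3)%N by rewrite -expnM.
apply: (@leq_trans (2 ^ 38 * M ^ 8 * (n * q ^ 2) ^ 3)).
  by rewrite expnMn mulnA mulnC leq_mul2r hn orbT.
rewrite (expnD 2 38 9) (expnD M 8 3) [leqRHS]mulnACA leq_mul2l; apply/orP; right.
by rewrite (expnM 2 3 3) -expnMn leq_exp2r.
Qed.

(** Seventh powers bring both alternatives to M^77. A pivot gives |A|^84; without one, q^42 |A|^63
    is at least |A|^78, because q^14 is at least |A|^5. *)
Theorem growth : (#|A| ^ 5 <= q ^ 14)%N -> (#|A| ^ 78 <= 2 ^ 329 * M ^ 77)%N.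
Proof.
have [g gA rg] := exists_regular_ball; have gS := ballS gA.
have A0 : (0 < #|A|)%N by apply/card_gt0P; exists 1%g.
move=> aq.
have [/exists_inP[x xS /exists_inP[a aA /andP[np piv]]]|H] :=
    boolP [exists x in SL2, [exists a in A, nonpivot g x && ~~ nonpivot g (a * x)%g]].
  have := pivot_growth gS rg xS aA np piv;
    rewrite -(@leq_exp2r _ _ 7) // expnMn -!expnM => h.
  apply: leq_trans (leq_trans h _); first by rewrite leq_pexp2l.
  by rewrite leq_mul2r leq_exp2l ?orbT.
(* The property holds at 1, as witnessed by [g] itself, and without a pivot it propagates along the
   generators. *)
have np x : x \in SL2 -> nonpivot g x.
  move=> xS; suff: (x \in SL2) && nonpivot g x by case/andP.
  move: xS; rewrite -genA; move: x; apply: (gen_mull_ind A1).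
    rewrite group1; apply/exists_inP; exists g => //.
    by rewrite invg1 mulg1 mul1g cent1id (regular_nscal gS rg).
  move=> a x aA /andP[xS np].
  rewrite (groupM (mem_gen aA) xS) /=; apply: contraT => piv; case/negP: H.
  by apply/exists_inP; exists x; rewrite -?genA //; apply/exists_inP; exists a => //;
    apply/andP.
have pow7 (r s t m : nat) : (r * s <= t * m -> r ^ 7 * s ^ 7 <= t ^ 7 * m ^ 7)%N.
  by rewrite -!expnMn leq_exp2r.
have := pow7 _ _ _ _ (nopivot_growth gS rg np); rewrite -!expnM => h.
apply: leq_trans h; rewrite (expnD _ 15 63) leq_mul2r; apply/orP; right.
by move: aq; rewrite -(@leq_exp2r _ _ 3) // -!expnM.
Qed.

End Growth.

(** * Dense subsets *)

Section Incidence.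
Variable F : finFieldType.
Local Notation q := #|F|.

Lemma sum_eq1 (a : F) : (\sum_c (a == c) = 1)%N.
Proof. by rewrite (bigD1 a) //= eqxx big1 // => c; rewrite eq_sym => /negPf->. Qed.

Lemma sum_eq_mul (a b : F) : (\sum_c (a == c) * (b == c) = (a == b))%N.
Proof.
rewrite (bigD1 a) //= eqxx big1 ?addn0 ?mul1n 1?eq_sym //.
by move=> c; rewrite eq_sym => /negPf->.
Qed.

Section Points.
Variable P : {set F * F}.
(** A pair [(x, c)] encodes the line of the points [p] with [L x p = c], and [N x c] counts the
    points of [P] on it. *)
Let L x (p : F * F) : F := x * p.1 + p.2.
Let N (x c : F) : nat := (\sum_(p in P) (L x p == c))%N.

Lemma sum_incidence : (\sum_x \sum_c N x c = q * #|P|)%N.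
Proof.
rewrite -sum_nat_const; apply: eq_bigr => x _.
rewrite exchange_big -sum1_card; apply: eq_bigr => p _; exact: sum_eq1.
Qed.

Lemma two_points_le (p p' : F * F) :
  (\sum_x (L x p == L x p') <= q * (p == p') + 1)%N.
Proof.
have [->|ne] := eqVneq p p'.
  apply: (@leq_trans (\sum_(x : F) 1)); first by apply: leq_sum => x _; case: eqP.
  by rewrite sum1_card muln1 leq_addr.
rewrite muln0 add0n.
have -> : (\sum_x (L x p == L x p') =
           #|[set x | L x p == L x p']|)%N.
  rewrite -sum1_card [RHS]big_mkcond; apply: eq_bigr => x _.
  by rewrite in_set; case: eqP.
apply/card_le1P => x; rewrite in_set => /eqP ex y; rewrite in_set inE.
apply/eqP/eqP => [ey|->//].
have e : (y - x) * (p.1 - p'.1) = 0.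
  transitivity ((L y p) - (L y p') - ((L x p) - (L x p'))).
    by rewrite /L; ring.
  by rewrite ex ey !subrr.
move/eqP: e; rewrite mulf_eq0 !subr_eq0 => /orP[/eqP //|/eqP e1].
case/eqP: ne; move: ex; rewrite /L e1 => /addrI e2.
by rewrite [p]surjective_pairing [p']surjective_pairing e1 e2.
Qed.

(** The square counts pairs of points on a common line; two distinct points share at most one line
    of this family. *)
Lemma sum_incidence_sq : (\sum_x \sum_c N x c ^ 2 <= q * #|P| + #|P| ^ 2)%N.
Proof.
have -> : (\sum_x \sum_c N x c ^ 2 =
    \sum_(p in P) \sum_(p' in P) \sum_x (L x p == L x p'))%N.
  transitivity (\sum_x \sum_(p in P) \sum_(p' in P) (L x p == L x p'))%N.
    apply: eq_bigr => x _.
    transitivity (\sum_c \sum_(p in P) \sum_(p' in P)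
       (L x p == c) * (L x p' == c))%N.
      by apply: eq_bigr => c _; rewrite -mulnn /N big_distrlr.
    rewrite exchange_big; apply: eq_bigr => p _.
    rewrite exchange_big; apply: eq_bigr => p' _; exact: sum_eq_mul.
  rewrite exchange_big; apply: eq_bigr => p _; exact: exchange_big.
apply: (@leq_trans (\sum_(p in P) \sum_(p' in P) (q * (p == p') + 1))).
  by apply: leq_sum => p _; apply: leq_sum => p' _; apply: two_points_le.
apply: (@leq_trans (\sum_(p in P) (q + #|P|))).
  apply: leq_sum => p pP; rewrite big_split /= sum1_card leq_add2r.
  rewrite (bigD1 p) //= eqxx muln1 big1 ?addn0 // => p' /andP[_].
  by rewrite eq_sym => /negPf ->; rewrite muln0.
by rewrite sum_nat_const mulnDr mulnn (mulnC #|P|).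
Qed.

(* Second moment method: the sum of [(q * N x c - #|P|) ^ 2] over all lines is
   at most [q ^ 3 * #|P|], and a line missing [P] contributes [#|P| ^ 2]. *)
Lemma missing_lines (X Z : {set F}) :
  {in X & Z, forall x c, N x c = 0%N} -> (#|X| * #|Z| * #|P| <= q ^ 3)%N.
Proof.
move=> N0; have [->|Pn] := eqVneq #|P| 0%N; first by rewrite muln0.
set n := #|P| in Pn *.
(* Pointwise 2ab <= a^2 + b^2; on a line missing [P] the left product vanishes, which leaves room
   for an extra [n ^ 2]. *)
have pw x c : (2 * (q * n * N x c) + ((x \in X) && (c \in Z)) * n ^ 2
    <= q ^ 2 * N x c ^ 2 + n ^ 2)%N.
  case: (boolP ((x \in X) && (c \in Z))) => [/andP[xX cZ]|_].
    by rewrite N0 // !muln0 mul1n.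
  rewrite mul0n addn0 -expnMn; have [h _] := nat_Cauchy (q * N x c) n.
  by rewrite mulnAC.
have : (\sum_x \sum_c (2 * (q * n * N x c) + ((x \in X) && (c \in Z)) * n ^ 2)
    <= \sum_x \sum_c (q ^ 2 * N x c ^ 2 + n ^ 2))%N.
  by apply: leq_sum => x _; apply: leq_sum => c _; apply: pw.
have -> : (\sum_x \sum_c (2 * (q * n * N x c) + ((x \in X) && (c \in Z)) * n ^ 2) =
   2 * (q * n * (q * n)) + #|X| * #|Z| * n ^ 2)%N.
  rewrite -[X in (2 * (q * n * X))%N]sum_incidence.
  have -> : (#|X| * #|Z| = \sum_x \sum_c ((x \in X) && (c \in Z)))%N.
    rewrite -!sum1_card big_distrlr /= big_mkcond; apply: eq_bigr => x _ /=.
    case: (x \in X) => /=; last by rewrite big1.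
    by rewrite big_mkcond; apply: eq_bigr => c _; case: (c \in Z).
  rewrite !big_distrl !big_distrr -big_split /=; apply: eq_bigr => x _.
  by rewrite !big_distrl !big_distrr -big_split.
have -> : (\sum_x \sum_c (q ^ 2 * N x c ^ 2 + n ^ 2) =
   q ^ 2 * (\sum_x \sum_c N x c ^ 2) + q ^ 2 * n ^ 2)%N.
  transitivity (\sum_(x : F) (q ^ 2 * (\sum_c N x c ^ 2) + q * n ^ 2))%N.
    by apply: eq_bigr => x _; rewrite big_split /= sum_nat_const big_distrr.
  by rewrite big_split /= sum_nat_const big_distrr /= mulnA mulnn.
have := sum_incidence_sq; rewrite -/n.
move: (\sum_x _)%N => S hS h.
have n0 : (0 < n)%N by rewrite lt0n.
rewrite -(leq_pmul2r n0).
have {}h : (2 * (q * n * (q * n)) + #|X| * #|Z| * n ^ 2 <=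
   q ^ 2 * (q * n + n ^ 2) + q ^ 2 * n ^ 2)%N.
  by apply: leq_trans h _; rewrite leq_add2r leq_mul2l hS orbT.
have e : (q ^ 2 * (q * n + n ^ 2) + q ^ 2 * n ^ 2 =
  2 * (q * n * (q * n)) + q ^ 3 * n)%N by ring.
by rewrite e leq_add2l -mulnn mulnA in h.
Qed.

End Points.

(** Without a solution, all lines with slope in [X] and constant in z - V miss the points of
    [setX Y W], against [missing_lines]. *)
Lemma sum_product_full (X Y W V : {set F}) z :
  (q ^ 3 < #|X| * #|Y| * #|W| * #|V|)%N ->
  exists x y w v, [/\ x \in X, y \in Y, w \in W & v \in V] /\ x * y + w + v = z.
Proof.
move=> big; pose Z := [set z - v | v in V].
have cZ : #|Z| = #|V| by apply: card_imset => a b /addrI /oppr_inj.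
case: (boolP [exists x in X, [exists v in V, [exists p in setX Y W,
  x * p.1 + p.2 == z - v]]]).
  case/exists_inP => x xX /exists_inP[v vV /exists_inP[[y w]]].
  rewrite in_setX /= => /andP[yY wW] /eqP e; exists x, y, w, v; split=> //.
  by rewrite e subrK.
move=> none; have := @missing_lines (setX Y W) X Z.
rewrite cardsX cZ => h; suff: (q ^ 3 < q ^ 3)%N by rewrite ltnn.
apply: leq_trans big _;
  rewrite (_ : #|X| * #|Y| * #|W| * #|V| = #|X| * #|V| * (#|Y| * #|W|))%N; last by ring.
apply: h => x c xX /imsetP[v vV ->]; apply: big1 => p pP.
case: eqP => // e; case/negP: none.
apply/exists_inP; exists x => //; apply/exists_inP; exists v => //.
by apply/exists_inP; exists p => //; apply/eqP.
Qed.

End Incidence.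

(** * Unipotent subgroups and factorization of SL_2 *)

Section Endgame.
Variable F : finFieldType.
Implicit Types u v g h x : GL2 F.
Local Notation SL2 := (SL2 F).
Local Notation q := #|F|.

Definition unip : {set GL2 F} :=
  [set u in SL2 | [&& e11 u == 1, e21 u == 0 & e22 u == 1]].

Lemma unipP u : reflect [/\ e11 u = 1, e21 u = 0 & e22 u = 1] (u \in unip).
Proof.
apply: (iffP setIdP) => [[_ /and3P[/eqP-> /eqP-> /eqP->]] //|[h1 h2 h3]].
by rewrite h1 h2 h3 !eqxx; split=> //; apply/inSLP; rewrite h1 h2 h3; ring.
Qed.

Lemma unip_group_set : group_set unip.
Proof.
apply/group_setP; split=> [|u v /unipP[u1 u2 u3] /unipP[v1 v2 v3]].
  by apply/unipP; rewrite !oneE.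
by apply/unipP; rewrite !mulE u1 u2 u3 v1 v2 v3; split; ring.
Qed.
Canonical unip_group := Group unip_group_set.

Definition diagt : {set GL2 F} := [set u in SL2 | (e12 u == 0) && (e21 u == 0)].

Lemma diagtP u : reflect [/\ u \in SL2, e12 u = 0 & e21 u = 0] (u \in diagt).
Proof.
apply: (iffP setIdP) => [[uS /andP[/eqP-> /eqP->]] //|[uS h1 h2]].
by rewrite h1 h2 !eqxx.
Qed.

Lemma diagt_group_set : group_set diagt.
Proof.
apply/group_setP; split=> [|u v /diagtP[uS u1 u2] /diagtP[vS v1 v2]].
  by apply/diagtP; rewrite !oneE group1.
by apply/diagtP; rewrite groupM // !mulE u1 u2 v1 v2; split=> //; ring.
Qed.
Canonical diagt_group := Group diagt_group_set.

Lemma card_unip_ge : (q <= #|unip|)%N.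
Proof.
rewrite -cardsT; apply: leq_trans (leq_imset_card (@e12 F) unip).
apply: subset_leq_card; apply/subsetP => b _.
have [|u uS [E1 E2 E3 E4]] := @SL_mk F 1 b 0 1; first by ring.
by apply/imsetP; exists u => //; apply/unipP.
Qed.

Lemma card_diagt_ge : (q.-1 <= #|diagt|)%N.
Proof.
rewrite -(cardsC1 (0 : F)); apply: leq_trans (leq_imset_card (@e11 F) diagt).
apply: subset_leq_card; apply/subsetP => a; rewrite !inE => a0.
have [|u uS [E1 E2 E3 E4]] := @SL_mk F a 0 0 a^-1; first by rewrite mulfV // mul0r addr0.
by apply/imsetP; exists u => //; apply/diagtP.
Qed.

Section Large.
Variable A : {set GL2 F}.
Hypotheses (A1 : 1%g \in A) (AV : (A^-1 = A)%g) (sA : A \subset SL2).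
Hypotheses (q_ge : (2 ^ 10 <= q)%N) (A_large : (q ^ 14 < #|A| ^ 5)%N).

Let q_gt0 : (0 < q)%N.
Proof. by apply/card_gt0P; exists 0. Qed.

Lemma large_unip : (#|A| <= #|[set e12 u | u in (A ^+ 2 :&: unip)%g]| * q ^ 2)%N.
Proof.
rewrite card_in_imset; last first.
  move=> u v /setIP[_ /unipP[u1 u2 u3]] /setIP[_ /unipP[v1 v2 v3]] e.
  by apply: GL2_eq; rewrite ?u1 ?u2 ?u3 ?v1 ?v2 ?v3.
have sU : unip \subset SL2 by apply/subsetP => u /setIdP[].
have := card_coset_ball AV sA (sU : unip_group \subset SL2) => h.
rewrite -(leq_pmul2r q_gt0) -mulnA -expnSr.
apply: leq_trans (leq_mul (leqnn _) card_unip_ge) (leq_trans h _).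
exact: leq_mul (leqnn _) (card_SL2_le F).
Qed.

(** Squares appear because conjugation by a diagonal matrix scales [e12] by the square of its [e11].
    One factor 2 is for squaring, the other for q <= 2 (q - 1). *)
Lemma large_diagt :
  (#|A| <= 4 * #|[set e11 u ^+ 2 | u in (A ^+ 2 :&: diagt)%g]| * q ^ 2)%N.
Proof.
set X := [set _ | u in _].
have DX : (#|(A ^+ 2 :&: diagt)%g| <= 2 * #|X|)%N.
  apply: (@leq_card_fibers _ _ _ _ (fun u => e11 u ^+ 2)) => [u uD|u uD].
    by apply/imsetP; exists u.
  apply: card_le2 => x y z.
  have key w : w \in [set x' in (A ^+ 2 :&: diagt)%g | e11 x' ^+ 2 == e11 u ^+ 2] ->
     [/\ e11 w ^+ 2 = e11 u ^+ 2, e11 w * e22 w = 1, e12 w = 0 & e21 w = 0].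
    case/setIdP => /setIP[_ /diagtP[wS w1 w2]] /eqP e; split=> //.
    by have /inSLP -> := wS; rewrite w1 w2 mul0r addr0.
  have same (w w' : GL2 F) : e11 w * e22 w = 1 -> e12 w = 0 -> e21 w = 0 ->
      e11 w' * e22 w' = 1 -> e12 w' = 0 -> e21 w' = 0 -> e11 w = e11 w' -> w = w'.
    move=> w1 w2 w3 w1' w2' w3' e; apply: GL2_eq; rewrite ?w2 ?w3 ?w2' ?w3' //.
    have a0 : e11 w != 0.
      by apply/eqP => a0; move/eqP: w1; rewrite a0 mul0r eq_sym oner_eq0.
    by apply: (mulfI a0); rewrite w1 e w1'.
  move=> /key[x0 x1 x2 x3] /key[y0 y1 y2 y3] /key[z0 z1 z2 z3] yx zx.
  have opp w : e11 w ^+ 2 = e11 u ^+ 2 -> e11 w * e22 w = 1 -> e12 w = 0 ->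
      e21 w = 0 -> w != x -> e11 w = - e11 x.
    move=> w0 w1 w2 w3 wx; have /eqP : e11 w ^+ 2 = e11 x ^+ 2 by rewrite w0 x0.
    rewrite eqf_sqr => /orP[|] /eqP // e; case/eqP: wx; exact: same w1 w2 w3 x1 x2 x3 e.
  apply: (same _ _ y1 y2 y3 z1 z2 z3).
  by rewrite (opp _ y0 y1 y2 y3 yx) (opp _ z0 z1 z2 z3 zx).
have sU : diagt \subset SL2 by apply/subsetP => u /setIdP[].
have h := card_coset_ball AV sA (sU : diagt_group \subset SL2).
have {}h : (#|A| * q.-1 <= 2 * #|X| * q ^ 3)%N.
  apply: leq_trans (leq_mul (leqnn _) card_diagt_ge) (leq_trans h _).
  by apply: leq_mul => //; apply: card_SL2_le.
have q2 : (q <= 2 * q.-1)%N.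
  have : (1 < q)%N by apply: leq_trans q_ge.
  by case: q => [//|k]; rewrite /=; clear; lia.
rewrite -(leq_pmul2r q_gt0) -mulnA -expnSr.
apply: leq_trans (leq_mul (leqnn #|A|) q2) _.
rewrite mulnCA; apply: leq_trans (leq_mul (leqnn 2) h) _.
by rewrite !mulnA.
Qed.

Lemma unip_sub_ball : unip \subset (A ^+ 10)%g.
Proof.
apply/subsetP => g /unipP[g1 g2 g3].
have hu := large_unip; have ht := large_diagt.
set Y := [set e12 u | u in _] in hu; set X := [set _ | u in _] in ht.
(* Otherwise |A|^4 <= 4 q^11, so q^56 < |A|^20 <= 4^5 q^55, which contradicts q >= 2^10. *)
have big : (q ^ 3 < #|X| * #|Y| * #|Y| * #|Y|)%N.
  rewrite ltnNge; apply/negP => small.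
  have : (#|A| ^ 4 <= 4 * q ^ 11)%N.
    rewrite (expnD _ 1 3) expn1.
    have hu3 : (#|A| ^ 3 <= (#|Y| * q ^ 2) ^ 3)%N by rewrite leq_exp2r.
    apply: leq_trans (leq_mul ht hu3) _.
    rewrite (expnD q 3 8).
    rewrite (_ : 4 * #|X| * q ^ 2 * (#|Y| * q ^ 2) ^ 3 =
      4 * (#|X| * #|Y| * #|Y| * #|Y| * q ^ 8))%N; last by ring.
    by rewrite leq_mul2l leq_mul2r small orbT.
  rewrite leqNgt => /negP; apply.
  rewrite -(@ltn_exp2r _ _ 5) // -expnM (mulnC 4 5) expnM.
  apply: (@leq_ltn_trans ((q ^ 14) ^ 4)); last by rewrite ltn_exp2r.
  rewrite expnMn -!expnM (expnD q 1 55) expn1 leq_mul2r; apply/orP; right.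
  exact: q_ge.
have [x [y [w [v [[xX yY wY vY] e]]]]] := sum_product_full (e12 g) big.
case/imsetP: xX => t /setIP[tA /diagtP[tS t1 t2]] ex.
case/imsetP: yY => u /setIP[uA /unipP[u1 u2 u3]] ey.
case/imsetP: wY => u' /setIP[uA' /unipP[u1' u2' u3']] ew.
case/imsetP: vY => u'' /setIP[uA'' /unipP[u1'' u2'' u3'']] ev.
(* The [e12] entry of this product is x y + w + v; its five factors from [A ^+ 2] account for the
   radius 10. *)
have -> : g = (t * u * t^-1 * u' * u'')%g.
  have [v1 v2 v3 v4] := SLV tS; have D := detE tS; rewrite t1 mul0r in D.
  have {}D : e11 t * e22 t = 1 by apply: (@addIr _ (-1)); rewrite -D subrr.
  apply: GL2_eq; rewrite ?g1 ?g2 ?g3 -?e ?ex ?ey ?ew ?ev !mulE ?v1 ?v2 ?v3 ?v4 ?u1 ?u2 ?u3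
    ?u1' ?u2' ?u3' ?u1'' ?u2'' ?u3'' ?t1 ?t2; ring: D.
apply: (ball_mul (i := 2 + 2 + 2 + 2) (j := 2)) => //.
by rewrite !ball_mul // ball_inv.
Qed.

End Large.

Section Full.
Variable A : {set GL2 F}.
Hypotheses (A1 : 1%g \in A) (AV : (A^-1 = A)%g) (sA : A \subset SL2).
Hypotheses (q_ge : (2 ^ 10 <= q)%N) (A_large : (q ^ 14 < #|A| ^ 5)%N).

Lemma expgn_conjs (B : {set GL2 F}) x k : ((B :^ x) ^+ k = (B ^+ k) :^ x)%g.
Proof.
elim: k => [|k IH]; first by rewrite !expg0 conjs1g.
by rewrite !expgS IH conjsMg.
Qed.

(** Conjugation by the Weyl element [w] exchanges upper and lower unipotents, so [unip_sub_ball] is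
    applied to the conjugate of [A]. *)
Lemma lower_sub_ball u : e11 u = 1 -> e12 u = 0 -> e22 u = 1 -> u \in (A ^+ 10)%g.
Proof.
move=> u1 u2 u3.
have [|w wS [E1 E2 E3 E4]] := @SL_mk F 0 1 (-1) 0; first by ring.
have [v1 v2 v3 v4] := SLV wS.
have := @unip_sub_ball (A :^ w)%g.
rewrite cardJg expgn_conjs => /(_ _ _ q_ge A_large) H.
have {H} /subsetP H : unip \subset (A ^+ 10 :^ w)%g.
  apply: H.
    by apply/setP => y; rewrite mem_invg !mem_conjg conjVg -mem_invg AV.
  by rewrite conj_subG.
rewrite -(memJ_conjg _ w) H //.
apply/unipP; rewrite conjgE !mulE v1 v2 v3 v4 u1 u2 u3 E1 E2 E3 E4.
by split; ring.
Qed.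

(** A matrix with [e21] nonzero is a product upper * lower * upper of unipotents, of length 30; one
    more lower unipotent makes [e21] nonzero in the remaining case. *)
Lemma endgame : (A ^+ 40)%g = SL2.
Proof.
have upper u : e11 u = 1 -> e21 u = 0 -> e22 u = 1 -> u \in (A ^+ 10)%g.
  by move=> h1 h2 h3; apply: (subsetP (unip_sub_ball AV sA q_ge A_large)); apply/unipP.
apply/eqP; rewrite eqEsubset; apply/andP; split.
  by apply: subset_trans (ball_gen _ _) _; rewrite gen_subG.
have main g : g \in SL2 -> e21 g != 0 -> g \in (A ^+ 30)%g.
  move=> gS c0.
  have [|s sS [s1 s2 s3 s4]] := @SL_mk F 1 ((e11 g - 1) / e21 g) 0 1; first by ring.
  have [|t tS [t1 t2 t3 t4]] := @SL_mk F 1 ((e22 g - 1) / e21 g) 0 1; first by ring.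
  have [|l lS [l1 l2 l3 l4]] := @SL_mk F 1 0 (e21 g) 1; first by ring.
  have -> : (g = s * l * t)%g.
    apply: GL2_eq; rewrite !mulE ?s1 ?s2 ?s3 ?s4 ?t1 ?t2 ?t3 ?t4 ?l1 ?l2 ?l3 ?l4;
      [| apply: (mulfI c0) | |]; try by field.
    by rewrite [LHS]mulrC (detE gS); field.
  apply: (ball_mul (i := 10 + 10) (j := 10)); last exact: upper.
  by apply: ball_mul; [exact: upper | exact: lower_sub_ball].
apply/subsetP => g gS; have [c0|c0] := eqVneq (e21 g) 0; last first.
  by apply: (ball_le A1 (i := 30)); last exact: main.
have a0 : e11 g != 0.
  by apply/eqP => a0; have /eqP := detE gS;
    rewrite a0 c0 mulr0 mul0r sub0r eq_sym oppr_eq0 oner_eq0.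
have [|l lS [l1 l2 l3 l4]] := @SL_mk F 1 0 1 1; first by ring.
rewrite -(mulKg l g); apply: (ball_mul (i := 10) (j := 30)).
  by apply: (ball_inv AV); apply: lower_sub_ball.
by apply: main; rewrite ?groupM // mulE l3 l4 c0; rewrite mul1r mulr0 addr0.
Qed.

End Full.
End Endgame.

Local Open Scope nat_scope.

(** * Iteration and diameter *)

(** Bernoulli's inequality 1 + m/n <= (1 + 1/n)^m, cleared of denominators. *)
Lemma bernoulli_expn n m : (n + m) * n ^ m <= n.+1 ^ m * n.
Proof.
elim: m => [|m IH]; first by rewrite addn0 !expn0 muln1 mul1n.
rewrite (expnS n.+1) -mulnA; apply: leq_trans (leq_mul (leqnn n.+1) IH).
rewrite expnS mulnA mulnA leq_mul2r; apply/orP; right.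
by clear; lia.
Qed.

Lemma double_expn n j : 0 < n -> 2 ^ j * n ^ (n * j) <= n.+1 ^ (n * j).
Proof.
move=> n0; rewrite !expnM -expnMn; have [->//|j0] := posnP j.
rewrite leq_exp2r // -(leq_pmul2r n0); apply: leq_trans (bernoulli_expn n n).
by rewrite addnn -mul2n mulnAC.
Qed.

Section Iteration.
Variable F : finFieldType.
Hypothesis two_neq0 : ((2 : F) != 0)%R.
Local Notation SL2 := (SL2 F).
Local Notation q := #|F|.
Hypothesis q_ge : 2 ^ 10 <= q.
Variable A : {set GL2 F}.
Hypotheses (A1 : 1%g \in A) (AV : (A^-1 = A)%g) (genA : <<A>>%g = SL2).
Variable c : nat.
Hypothesis c_ge : 2 ^ 329 * 2 ^ 329 <= c.

Lemma gen_ball k : 0 < k -> <<A ^+ k>>%g = SL2.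
Proof.
move=> k0; apply/eqP; rewrite eqEsubset -{1}genA gen_subG ball_gen /= -genA.
by apply: genS; rewrite -{1}[A]expg1 ball_sub.
Qed.

Lemma c_gt0 : 0 < c.
Proof. by apply: leq_trans c_ge; rewrite muln_gt0 !expn_gt0. Qed.

(** Squaring [growth] gives exponents 156 and 154 and the constant 2^658, which one factor of the
    ball size, at least [c], absorbs. *)
Lemma growth_step k : 0 < k -> c <= #|A ^+ k|%g -> #|A ^+ k|%g ^ 5 <= q ^ 14 ->
  #|A ^+ k|%g ^ 155 <= #|A ^+ (k * 64)|%g ^ 154.
Proof.
move=> k0 ck small.
have q4 : 4 < q by apply: leq_trans q_ge.
have AkV : ((A ^+ k)^-1 = A ^+ k)%g by rewrite -expVgn AV.
have := growth two_neq0 q4 (ball_one A1 k) AkV (gen_ball k0) small.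
rewrite -expgnA; move: #|(A ^+ k)%g| #|(A ^+ (k * 64))%g| ck => a m ca h.
have a0 : 0 < a by apply: leq_trans ca; apply: c_gt0.
rewrite -(leq_pmul2l a0) -expnS (expnM a 78 2).
have sq (x y z : nat) : x <= y * z -> x ^ 2 <= y * y * z ^ 2.
  by move=> xyz; rewrite mulnn -expnMn leq_exp2r.
apply: leq_trans (sq _ _ _ h) _; rewrite -expnM leq_mul2r; apply/orP; right.
exact: leq_trans c_ge ca.
Qed.

(** The starting radius [c] ensures that the ball either is the whole group or has the size that
    [growth_step] requires. *)
Lemma iterate_growth i :
  [\/ (A ^+ c = SL2)%g,
      exists2 j, j <= i & q ^ 14 < #|A ^+ (c * 64 ^ j)|%g ^ 5 |
      c ^ (155 ^ i) <= #|A ^+ (c * 64 ^ i)|%g ^ (154 ^ i)].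
Proof.
elim: i => [|i [H|[j ji H]|IH]].
- case: (ball_growth A1 c) => [H|->]; last by constructor 1.
  by constructor 3; rewrite !expn0 muln1 !expn1 ltnW.
- by constructor 1.
- by constructor 2; exists j => //; apply: ltnW.
have [big|small] := ltnP (q ^ 14) (#|A ^+ (c * 64 ^ i)|%g ^ 5).
  by constructor 2; exists i.
case: (ball_growth A1 c) => [Hc|->]; last by constructor 1.
have ck : c <= #|A ^+ (c * 64 ^ i)|%g.
  apply: leq_trans (ltnW Hc) _; apply: (ball_card_le A1).
  by rewrite leq_pmulr // expn_gt0.
have k0 : 0 < c * 64 ^ i by rewrite muln_gt0 c_gt0 expn_gt0.
have := growth_step k0 ck small; rewrite -mulnA -expnSr => h; constructor 3.
rewrite (expnS 154) (expnM _ 154) expnSr (expnM c).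
have e1 : 0 < 154 ^ i by rewrite expn_gt0.
apply: leq_trans (_ : (#|A ^+ (c * 64 ^ i)|%g ^ 155) ^ (154 ^ i) <= _);
  last by rewrite leq_exp2r.
apply: (@leq_trans ((#|A ^+ (c * 64 ^ i)|%g ^ (154 ^ i)) ^ 155));
  first by rewrite leq_exp2r.
by rewrite -(expnM _ (154 ^ i)) (mulnC (154 ^ i)) expnM.
Qed.

Lemma ball_full_of_large k : 0 < k -> q ^ 14 < #|A ^+ k|%g ^ 5 -> (A ^+ (k * 40) = SL2)%g.
Proof.
move=> k0 big; rewrite expgnA; apply: endgame => //.
- exact: ball_one.
- by rewrite -expVgn AV.
- by rewrite -genA ball_gen.
Qed.

Lemma full_le k l : k <= l -> (A ^+ k = SL2)%g -> (A ^+ l = SL2)%g.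
Proof.
move=> kl e; apply/eqP; rewrite eqEsubset -{1}genA ball_gen /= -e.
exact: ball_sub.
Qed.

(** The third outcome of [iterate_growth] is impossible: the group has at most 2^(3L) elements, and
    2^(3L 154^i) < 2^(155^i) <= c^(155^i). *)
Lemma ball_full_iter L i : q <= 2 ^ L -> 3 * L * 154 ^ i < 155 ^ i ->
  (A ^+ (c * 64 ^ i * 40) = SL2)%g.
Proof.
move=> qL Li; case: (iterate_growth i) => [h|[j ji h]|h].
- apply: full_le h; rewrite -mulnA leq_pmulr //.
  by rewrite muln_gt0 expn_gt0.
- have := ball_full_of_large _ h; rewrite muln_gt0 c_gt0 expn_gt0 => /(_ isT).
  by apply: full_le; rewrite leq_mul2r leq_mul2l leq_pexp2l ?orbT.
suff : c ^ (155 ^ i) < c ^ (155 ^ i) by rewrite ltnn.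
have i0 : 0 < 154 ^ i by rewrite expn_gt0.
have bound : #|A ^+ (c * 64 ^ i)|%g <= 2 ^ (L * 3).
  apply: (@leq_trans #|SL2|); first by rewrite subset_leq_card // -genA ball_gen.
  by apply: leq_trans (card_SL2_le F) _; rewrite expnM leq_exp2r.
apply: leq_ltn_trans h _.
apply: (@leq_ltn_trans ((2 ^ (L * 3)) ^ (154 ^ i))); first by rewrite leq_exp2r.
rewrite -expnM (mulnC L); apply: (@leq_trans (2 ^ (155 ^ i))); first by rewrite ltn_exp2l.
rewrite leq_exp2r; last by rewrite expn_gt0.
apply: leq_trans c_ge; rewrite -expnD.
by rewrite -{1}(expn1 2) leq_exp2l.
Qed.

(** Since (155/154)^154 >= 2, it suffices to take 154 j steps with 3L < 2^j <= 6L. The radius is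
    multiplied by 64^(154 j) = (2^j)^924, as 924 = 6 * 154. *)
Lemma ball_full_polylog L : 0 < L -> q <= 2 ^ L ->
  (A ^+ (40 * c * (6 * L) ^ 924) = SL2)%g.
Proof.
move=> L0 qL; pose j := (trunc_log 2 (3 * L)).+1.
have L3 : 0 < 3 * L by rewrite muln_gt0.
have j1 : 2 ^ j <= 6 * L.
  by rewrite expnS (_ : 6 * L = 2 * (3 * L)) ?leq_mul2l ?trunc_logP // mulnA.
have j2 : 3 * L < 2 ^ j by apply: trunc_log_ltn.
have full : (A ^+ (c * 64 ^ (154 * j) * 40) = SL2)%g.
  apply: (ball_full_iter qL).
  apply: leq_trans (double_expn j (isT : 0 < 154)); rewrite ltn_mul2r j2 andbT.
  by rewrite expn_gt0.
have e64 : 64 ^ (154 * j) = (2 ^ j) ^ 924.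
  by rewrite (_ : 64 = 2 ^ 6) // -!expnM mulnA mulnC.
apply: full_le full; rewrite mulnC mulnA e64 leq_mul2l leq_exp2r //.
by rewrite j1 orbT.
Qed.

End Iteration.

Lemma Fp_two_neq0 p : prime p -> 2 < p -> ((2 : 'F_p) != 0)%R.
Proof.
move=> pp p2; rewrite -(dvdn_pcharf (pchar_Fp pp)).
by apply/negP => /(dvdn_leq (isT : 0 < 2)); rewrite leqNgt p2.
Qed.

Lemma SL2_ball_polylog : exists C : nat, forall (p : nat) (A : {set GL2 'F_p}),
  prime p -> 1%g \in A -> (A^-1 = A)%g -> <<A>>%g = SL2 'F_p ->
  (A ^+ (C * (trunc_log 2 p).+1 ^ 924))%g = SL2 'F_p.
Proof.
have [c hc] : exists c, 2 ^ 329 * 2 ^ 329 <= c.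
  exists (2 ^ 329 * 2 ^ 329); exact: leqnn.
have [k hk] : exists k, 6 ^ 924 <= k by exists (6 ^ 924); exact: leqnn.
have [d hd] : exists d, (2 ^ 10) ^ 3 <= d by exists ((2 ^ 10) ^ 3); exact: leqnn.
exists (40 * c * k + d) => p A pp A1 AV genA.
(* Small primes, 2 among them, are covered by the crude radius |SL_2|, at most (2^10)^3. *)
have [small|big] := ltnP p (2 ^ 10).
  have full := ball_card_full A1 genA.
  apply: (full_le A1 genA _ full).
  apply: leq_trans (card_SL2_le _) _; rewrite card_Fp //.
  apply: (@leq_trans d); first by apply: leq_trans hd; rewrite leq_exp2r // ltnW.
  apply: leq_trans (leq_addl (40 * c * k) d) _.
  by apply: leq_pmulr; rewrite expn_gt0.
have p2 : 2 < p by apply: leq_trans big.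
have q_ge : 2 ^ 10 <= #|'F_p| by rewrite card_Fp.
have := @ball_full_polylog _ (Fp_two_neq0 pp p2) q_ge A A1 AV genA c hc (trunc_log 2
  p).+1.
rewrite card_Fp // => /(_ isT (ltnW (trunc_log_ltn p (isT : 1 < 2)))).
apply: (full_le A1 genA); rewrite expnMn mulnA leq_mul2r; apply/orP; right.
apply: leq_trans (leq_addr _ _); rewrite leq_mul2l; apply/orP; right.
exact: hk.
Qed.

(** * From balls to the diameter of the Cayley graph *)

Lemma cayley_walk (gT : finGroupType) (G : {group gT}) (A : {set gT}) n x y :
  A \subset G -> x \in G -> y \in ((1 |: (A :|: A^-1)) ^+ n)%g ->
  exists s, [/\ path (cayley_graph G A) x s, last x s = (y * x)%g & size s <= n].
Proof.
move=> sAG xG; elim: n y => [|n IH] y.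
  by rewrite expg0 => /set1P ->; exists [::]; rewrite mul1g.
rewrite expgS => /mulsgP[a z aA zA ->].
have zG : z \in G.
  have sub : (1 |: (A :|: A^-1))%g \subset G.
    by rewrite !subUset sub1set group1 sAG -(invGid G) invSg.
  move: z zA; apply/subsetP; apply: subset_trans (ball_gen _ n) _.
  by rewrite gen_subG.
have [s [sp sl ss]] := IH _ zA.
(* A letter 1 adds no step, and a letter of the inverse set follows an edge backwards. *)
case/setU1P: aA => [->|aA].
  by exists s; rewrite mul1g; split=> //; apply: ltnW.
exists (rcons s (a * z * x)%g); rewrite rcons_path last_rcons size_rcons sp sl.
split=> //=; apply/exists_inP.
case/setUP: aA => aA.
  by exists a => //; apply/orP; right; rewrite groupM //= mulgA.
have aA' : (a^-1)%g \in A by rewrite -mem_invg.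
exists (a^-1)%g => //; apply/orP; left.
rewrite !groupM //=; first by rewrite -!mulgA mulKg.
by rewrite -groupV; apply: subsetP aA'.
Qed.

Lemma symmetrize_gen (gT : finGroupType) (G : {group gT}) (A : {set gT}) :
  <<A>>%g = G -> let B := (1 |: (A :|: A^-1))%g in
  [/\ A \subset G, 1%g \in B, (B^-1 = B)%g & <<B>>%g = G].
Proof.
move=> genA B; have sA : A \subset G by rewrite -genA subset_gen.
split=> //; first by rewrite setU11.
  apply/setP => x; rewrite mem_invg !in_setU !in_set1 !mem_invg invgK invg_eq1.
  by rewrite (orbC (x^-1 \in A)%g).
apply/eqP; rewrite eqEsubset; apply/andP; split.
  by rewrite gen_subG !subUset sub1set group1 sA -(invGid G) invSg.
by rewrite -{1}genA; apply: genS; apply/subsetP => x xA; rewrite !in_setU xA orbT.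
Qed.

From mathcomp Require Import all_classical all_reals all_analysis.

Import Order.TTheory GRing.Theory Num.Theory.
Local Open Scope ring_scope.

Lemma diameter_le (R : realType) (gT : finGroupType) (G : {group gT}) (A : {set gT}) n :
  A \subset G -> ((1 |: (A :|: A^-1)) ^+ n)%g = G ->
  (diameter R G (cayley_graph G A) <= n%:R%:E)%E.
Proof.
move=> sAG full; apply: ge_ereal_sup => _ [[x y] /= [xG yG] <-].
have yx : (y * x^-1)%g \in ((1 |: (A :|: A^-1)) ^+ n)%g by rewrite full groupM ?groupV.
have [s [sp sl ss]] := cayley_walk sAG xG yx.
apply: ge_ereal_inf; exists ((size s)%:R%:E); last by rewrite lee_fin ler_nat.
by exists s => //; split=> //; rewrite sl mulgKV.
Qed.

Lemma trunc_log2_le_ln (R : realType) p : (1 < p)%N ->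
  ((trunc_log 2 p).+1%:R : R) <= 2 / ln 2 * ln p%:R.
Proof.
move=> p1; set t := trunc_log 2 p.
have t0 : (0 < t)%N by rewrite trunc_log_gt0.
have ln2 : 0 < ln (2 : R) by rewrite ln_gt0 // ltr1n.
have tp : t%:R * ln (2 : R) <= ln p%:R.
  rewrite mulr_natl -lnXn // ler_ln ?posrE ?exprn_gt0 ?ltr0n //; last exact: ltnW.
  by rewrite -natrX ler_nat trunc_logP // ltnW.
(* As [t] is positive, t + 1 <= 2t. *)
apply: (@le_trans _ _ (2 * t%:R)).
  by rewrite -natrM ler_nat mul2n -addnn -addn1 leq_add2l.
by rewrite -mulrA ler_pM2l // mulrC ler_pdivlMr.
Qed.

Theorem mainTheorem1 (R : realType) :
  exists c C : R,
    [/\ 0 < c, 0 < C &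
      forall (p : nat) (A : {set {'GL_2['F_p]}}),
        prime p -> (<<A>> = 'SL_2['F_p])%g ->
        (diameter R 'SL_2['F_p]%g (cayley_graph 'SL_2['F_p]%g A)
          <= (C * ln p%:R `^ c)%:E)%E].
Proof.
have [C hC] := SL2_ball_polylog.
have ln2 : 0 < ln (2 : R) by rewrite ln_gt0 // ltr1n.
(* The power of 2 / ln 2 converts the binary logarithm to [ln]; the successor of [C] keeps the
   constant positive. *)
exists 924%:R, (C.+1%:R * (2 / ln 2) ^+ 924); split.
- by rewrite ltr0n.
- by rewrite mulr_gt0 ?ltr0n // exprn_gt0 // divr_gt0.
move=> p A pp genA'.
have genA : <<(A : {set GL2 'F_p})>>%g = SL2 'F_p by exact: genA'.
have [sA B1 BV genB] := symmetrize_gen genA.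
apply: le_trans (@diameter_le R _ (SL2 'F_p) A _ sA (hC p _ pp B1 BV genB)) _.
rewrite lee_fin powR_mulrn; last by rewrite ln_ge0 // ler1n prime_gt0.
rewrite natrM -mulrA -exprMn ler_pM ?ler0n //; first by rewrite ler_nat.
by rewrite natrX lerXn2r ?nnegrE ?ler0n ?trunc_log2_le_ln ?prime_gt1 // (le_trans _
  (trunc_log2_le_ln _ _)) ?ler0n ?prime_gt1.
Qed.
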